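(* Let $k$ be an algebraically closed field and let $\mathcal{C}$ be a pivotal finite tensor category over $k$. Then a non-zero two-sided modified trace on $\mathrm{Proj}(\mathcal{C})$ exists if and only if $\mathcal{C}$ (with its pivotal structure) is spherical.
   Context: A finite abelian category is a $k$-linear category equivalent to the category of finite-dimensional left modules over a finite-dimensional $k$-algebra. A finite tensor category is a finite abelian category $\mathcal{C}$ that is a rigid monoidal category (assumed strict) with $k$-bilinear tensor product and simple unit object $\mathbb{1}$. $\mathrm{Proj}(\mathcal{C})$ is the full subcategory of projective objects. $X^*$ is the left dual of $X$ with $\mathrm{ev}_X:X^*\otimes X\to\mathbb{1}$, $\mathrm{coev}_X:\mathbb{1}\to X\otimes X^*$; ${}^*X$ is the right dual with $\mathrm{ev}'_X:X\otimes{}^*X\to\mathbb{1}$, $\mathrm{coev}'_X:\mathbb{1}\to{}^*X\otimes X$. The duality functors are assumed strict monoidal and mutually inverse, so ${}^*(X^* )=X=({}^*X)^*$. A pivotal structure is an isomorphism $\mathfrak{p}:\mathrm{id}_{\mathcal{C}}\to(-)^{**}$ of monoidal functors; $\mathcal{C}$ pivotal means it is equipped with one. Closing operators: for $f:M\otimes X\to N\otimes X^{**}$ put $\mathrm{cl}^r_{M,N|X}(f)=(\mathrm{id}_N\otimes\mathrm{ev}_{X^*})(f\otimes\mathrm{id}_{X^*})(\mathrm{id}_M\otimes\mathrm{coev}_X):M\to N$; for $f:X\otimes M\to{}^{**}X\otimes N$ put $\mathrm{cl}^l_{X|M,N}(f)=(\mathrm{ev}'_{{}^*X}\otimes\mathrm{id}_N)(\mathrm{id}_{{}^*X}\otimes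 f)(\mathrm{coev}'_X\otimes\mathrm{id}_M):M\to N$. A two-sided modified trace on $\mathrm{Proj}(\mathcal{C})$ is a family of $k$-linear maps $\mathtt{t}_P:\mathrm{Hom}_{\mathcal{C}}(P,P)\to k$ ($P$ projective) with $\mathtt{t}_P(gf)=\mathtt{t}_Q(fg)$ for all $f:P\to Q$, $g:Q\to P$ between projectives, and, for all projective $P$ and all $X\in\mathcal{C}$: (right) $\mathtt{t}_P(\mathrm{cl}^r_{P,P|X}(f))=\mathtt{t}_{P\otimes X}((\mathrm{id}_P\otimes\mathfrak{p}_X^{-1})f)$ for all $f:P\otimes X\to P\otimes X^{**}$; (left) $\mathtt{t}_P(\mathrm{cl}^l_{X|P,P}(f))=\mathtt{t}_{X\otimes P}((\mathfrak{p}_{{}^{**}X}\otimes\mathrm{id}_P)f)$ for all $f:X\otimes P\to{}^{**}X\otimes P$. Nakayama functor: for finite-dimensional $V$ and $M\in\mathcal{C}$, $V\cdot M$ is defined by $\mathrm{Hom}_{\mathcal{C}}(V\cdot M,N)\cong\mathrm{Hom}_k(V,\mathrm{Hom}_{\mathcal{C}}(M,N))$; $\mathbb{N}(M)=\int^{Z\in\mathcal{C}}\mathrm{Hom}_{\mathcal{C}}(M,Z)^*\cdot Z$ with universal dinatural transformation $\mathbb{i}_{Z,M}$. It has canonical isomorphisms $\Psi^{\mathbb{N}}_{M,X}:\mathbb{N}(M)\otimes X^{**}\to\mathbb{N}(M\otimes X)$ and $\Phi^{\mathbb{N}}_{X,M}:{}^{**}X\otimes\mathbb{N}(M)\to\mathbb{N}(X\otimes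 M)$, uniquely determined by requiring, for all $Z$ and up to the canonical isomorphisms $(V\cdot Z)\otimes X^{**}\cong V\cdot(Z\otimes X^{**})$ and ${}^{**}X\otimes(V\cdot Z)\cong V\cdot({}^{**}X\otimes Z)$: $\Psi^{\mathbb{N}}_{M,X}\circ(\mathbb{i}_{Z,M}\otimes\mathrm{id}_{X^{**}})=\mathbb{i}_{Z\otimes X^{**},M\otimes X}\circ((\mathrm{cl}^r_{M,Z|X})^*\cdot\mathrm{id})$ and $\Phi^{\mathbb{N}}_{X,M}\circ(\mathrm{id}_{{}^{**}X}\otimes\mathbb{i}_{Z,M})=\mathbb{i}_{{}^{**}X\otimes Z,X\otimes M}\circ((\mathrm{cl}^l_{X|M,Z})^*\cdot\mathrm{id})$. Put $\alpha_{\mathcal{C}}=\mathbb{N}(\mathbb{1})$; $\mathcal{C}$ is unimodular if $\alpha_{\mathcal{C}}\cong\mathbb{1}$. The Radford isomorphism is $g_X=(\Psi^{\mathbb{N}}_{\mathbb{1},X})^{-1}\circ\Phi^{\mathbb{N}}_{X,\mathbb{1}}:{}^{**}X\otimes\alpha_{\mathcal{C}}\to\alpha_{\mathcal{C}}\otimes X^{**}$. $\mathcal{C}$ is spherical if it is unimodular and, for an (equivalently any) isomorphism $f:\mathbb{1}\to\alpha_{\mathcal{C}}$, $g_X\circ(\mathrm{id}_{{}^{**}X}\otimes f)=(f\otimes\mathrm{id}_{X^{**}})\circ\mathfrak{p}_X\circ\mathfrak{p}_{{}^{**}X}$ for all $X\in\mathcal{C}$. *)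

(* Defs.v *)
From HB Require Import structures.
From mathcomp Require Import all_boot all_order all_algebra all_field.

Set Implicit Arguments.
Unset Strict Implicit.
Unset Printing Implicit Defensive.

Import GRing.Theory.
Local Open Scope ring_scope.

Declare Scope tc_scope.
Delimit Scope tc_scope with tc.
Local Open Scope tc_scope.

Reserved Notation "g \oc f" (at level 50, left associativity).
Reserved Notation "X \ox Y" (at level 40, left associativity).
Reserved Notation "f \om g" (at level 40, left associativity).
Reserved Notation "X ^l" (at level 1, left associativity, format "X ^l").
Reserved Notation "X ^r" (at level 1, left associativity, format "X ^r").

(** * Linear categories *)

(* Hom spaces are finite-dimensional: this is automatic in a finite abelian
   category, and a [vectType] structure is only a choice of a basis. *)
Record linCat (k : fieldType) := LinCat {
  obj :> Type;
  hom : obj -> obj -> vectType k;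
  idm : forall X, hom X X;
  comp : forall X Y Z, hom Y Z -> hom X Y -> hom X Z;
  comp1m : forall X Y (f : hom X Y), comp (idm Y) f = f;
  compm1 : forall X Y (f : hom X Y), comp f (idm X) = f;
  compA : forall X Y Z W (h : hom Z W) (g : hom Y Z) (f : hom X Y),
    comp h (comp g f) = comp (comp h g) f;
  comp_linl : forall X Y Z (f : hom X Y),
    linear (fun g : hom Y Z => comp g f);
  comp_linr : forall X Y Z (g : hom Y Z),
    linear (fun f : hom X Y => comp g f)
}.

Arguments hom {k l} _ _.
Arguments idm {k l} _.
Notation "g \oc f" := (comp g f) : tc_scope.

Section Morphisms.
Variables (k : fieldType) (C : linCat k).
Implicit Types X Y Z M N P : C.

Definition inverse X Y (f : hom X Y) (g : hom Y X) : Prop :=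
  g \oc f = idm X /\ f \oc g = idm Y.

Definition isom X Y (f : hom X Y) : Prop := exists g, inverse f g.

Definition epi X Y (f : hom X Y) : Prop :=
  forall Z (g h : hom Y Z), g \oc f = h \oc f -> g = h.

Definition mono X Y (f : hom X Y) : Prop :=
  forall Z (g h : hom Z X), f \oc g = f \oc h -> g = h.

Definition projective P : Prop :=
  forall X Y (e : hom X Y) (f : hom P Y), epi e -> exists g, e \oc g = f.

Definition zero_object X : Prop := idm X = 0.

Definition simple_object X : Prop :=
  ~ zero_object X /\
  forall Y (m : hom Y X), mono m -> zero_object Y \/ isom m.

(* The identity morphism, seen through an equality between objects; strict
   monoidal structures are expressed by means of these morphisms. *)
Definition castm X Y (e : X = Y) : hom X Y :=
  match e in _ = Z return hom X Z with erefl => idm X end.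

Definition postm M X Y (g : hom X Y) : 'Hom(hom M X, hom M Y) :=
  linfun (fun f => g \oc f).

Definition prem X Y N (f : hom X Y) : 'Hom(hom Y N, hom X N) :=
  linfun (fun g => g \oc f).

End Morphisms.

(* [linfun f] is only meaningful for a linear [f]; the lemmas [linfun_linE],
   [postmE], [premE], [dualE], [tensmrE], [tensmlE], [clrmE] and [cllmE]
   below certify this for all of its uses. *)
Lemma linfun_linE (k : fieldType) (U V : vectType k) (f : U -> V) :
  linear f -> linfun f =1 f.
Proof.
move=> f_lin u.
pose fL := GRing.isLinear.Build k U V *:%R f f_lin.
pose F : {linear U -> V} := HB.pack f fL.
exact: (lfunE F u).
Qed.

Lemma postmE (k : fieldType) (C : linCat k) (M X Y : C) (g : hom X Y)
  (f : hom M X) : postm M g f = g \oc f.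
Proof. by rewrite linfun_linE //; exact: comp_linr. Qed.

Lemma premE (k : fieldType) (C : linCat k) (X Y N : C) (f : hom X Y)
  (g : hom Y N) : prem N f g = g \oc f.
Proof. by rewrite linfun_linE //; exact: comp_linl. Qed.

(** * Finite abelian categories *)

Record functor (k : fieldType) (C D : linCat k) := Functor {
  fobj :> C -> D;
  fmap : forall X Y : C, 'Hom(hom X Y, hom (fobj X) (fobj Y));
  fmap1 : forall X, fmap X X (idm X) = idm (fobj X);
  fmapM : forall X Y Z (g : hom Y Z) (f : hom X Y),
    fmap X Z (g \oc f) = fmap Y Z g \oc fmap X Y f
}.

Definition equivalent (k : fieldType) (C D : linCat k) : Prop :=
  exists (F : functor C D) (G : functor D C)
    (eta : forall X : C, hom X (G (F X)))
    (eps : forall Y : D, hom (F (G Y)) Y),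
  [/\ forall X, isom (eta X),
      forall Y, isom (eps Y),
      forall X X' (f : hom X X'),
        eta X' \oc f = fmap G _ _ (fmap F _ _ f) \oc eta X
    & forall Y Y' (f : hom Y Y'),
        eps Y' \oc fmap F _ _ (fmap G _ _ f) = f \oc eps Y].

Section ModuleCategory.
Variables (k : fieldType) (A : falgType k).

Record fdmod := FdMod {
  car : vectType k;
  act : 'Hom(A, 'End(car));
  act1 : act 1 = \1%VF;
  actM : forall a b, act (a * b) = (act a \o act b)%VF
}.

Definition act_defect (V W : fdmod) (a : A) (f : 'Hom(car V, car W)) :
  'Hom(car V, car W) := (act W a \o f)%VF - (f \o act V a)%VF.

Lemma act_defect_linear V W a : linear (@act_defect V W a).
Proof.
move=> c f g; rewrite /act_defect comp_lfunDr comp_lfunDl -comp_lfunZr.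
by rewrite -comp_lfunZl scalerBr opprD addrACA.
Qed.

Definition modhom (V W : fdmod) : {vspace 'Hom(car V, car W)} :=
  (\bigcap_(i < \dim (fullv : {vspace A}))
     lker (linfun (@act_defect V W (vbasis (fullv : {vspace A}))`_i)))%VS.

Lemma modhomP V W (f : 'Hom(car V, car W)) :
  reflect (forall a v, f (act V a v) = act W a (f v)) (f \in modhom V W).
Proof.
apply: (iffP idP) => [|Hf]; last first.
  rewrite memvE; apply/subv_bigcapP => i _; rewrite -memvE memv_ker.
  rewrite linfun_linE; last exact: act_defect_linear.
  rewrite subr_eq0; apply/eqP/lfunP => v.
  by rewrite !comp_lfunE Hf.
rewrite memvE => /subv_bigcapP Hf a v.
rewrite (coord_vbasis (memvf a)) !linear_sum !sum_lfunE linear_sum /=.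
apply: eq_bigr => i _; rewrite !linearZ !scale_lfunE linearZ /=; congr (_ *: _).
have := Hf i isT; rewrite -memvE memv_ker.
rewrite linfun_linE; last exact: act_defect_linear.
by rewrite subr_eq0 => /eqP/lfunP/(_ v); rewrite !comp_lfunE.
Qed.

Lemma modhom_id V : \1%VF \in modhom V V.
Proof. by apply/modhomP => a v; rewrite !id_lfunE. Qed.

Lemma modhom_comp U V W (g : subvs_of (modhom V W)) (f : subvs_of (modhom U V)) :
  (vsval g \o vsval f)%VF \in modhom U W.
Proof.
apply/modhomP => a v; rewrite !comp_lfunE.
by rewrite (modhomP _ (subvsP f)) (modhomP _ (subvsP g)).
Qed.

Definition modCat : linCat k.
Proof.
refine (@LinCat k fdmod (fun V W => subvs_of (modhom V W))
  (fun V => Subvs (modhom_id V))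
  (fun U V W g f => Subvs (modhom_comp g f)) _ _ _ _ _).
- by move=> X Y f; apply: val_inj; rewrite /= comp_lfun1l.
- by move=> X Y f; apply: val_inj; rewrite /= comp_lfun1r.
- by move=> X Y Z W h g f; apply: val_inj; rewrite /= comp_lfunA.
- move=> X Y Z f a g g'; apply: val_inj.
  by rewrite /= comp_lfunDl comp_lfunZl.
- move=> X Y Z g a f f'; apply: val_inj.
  by rewrite /= comp_lfunDr comp_lfunZr.
Defined.

End ModuleCategory.

(* A [falgType] is a nonzero algebra, which only excludes the zero category. *)
Definition finite_abelian (k : fieldType) (C : linCat k) : Prop :=
  exists A : falgType k, equivalent C (modCat A).

(** * Strict monoidal categories *)

Record monCat (k : fieldType) := MonCat {
  mcat :> linCat k;
  one : mcat;
  tens : mcat -> mcat -> mcat;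
  tensm : forall X Y X' Y' : mcat,
    hom X Y -> hom X' Y' -> hom (tens X X') (tens Y Y');
  tensm_linl : forall X Y X' Y' (g : hom X' Y'),
    linear (fun f : hom X Y => tensm f g);
  tensm_linr : forall X Y X' Y' (f : hom X Y),
    linear (fun g : hom X' Y' => tensm f g);
  tensm1 : forall X Y, tensm (idm X) (idm Y) = idm (tens X Y);
  tensmM : forall X Y Z X' Y' Z' (g : hom Y Z) (f : hom X Y)
    (g' : hom Y' Z') (f' : hom X' Y'),
    tensm (g \oc f) (g' \oc f') = tensm g g' \oc tensm f f';
  tensA : forall X Y Z, tens (tens X Y) Z = tens X (tens Y Z);
  tens1X : forall X, tens one X = X;
  tensX1 : forall X, tens X one = X;
  tensmA : forall X Y Z X' Y' Z'
    (f : hom X X') (g : hom Y Y') (h : hom Z Z'),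
    castm (tensA X' Y' Z') \oc tensm (tensm f g) h
      = tensm f (tensm g h) \oc castm (tensA X Y Z);
  tensm1f : forall X Y (f : hom X Y),
    castm (tens1X Y) \oc tensm (idm one) f = f \oc castm (tens1X X);
  tensmf1 : forall X Y (f : hom X Y),
    castm (tensX1 Y) \oc tensm f (idm one) = f \oc castm (tensX1 X)
}.

Arguments one {k m}.
Notation "X \ox Y" := (tens X Y) : tc_scope.
Notation "f \om g" := (tensm f g) : tc_scope.

Section MonoidalCasts.
Variables (k : fieldType) (C : monCat k).
Implicit Types X Y Z : C.

Definition asso X Y Z : hom (X \ox Y \ox Z) (X \ox (Y \ox Z)) :=
  castm (tensA X Y Z).
Definition assoV X Y Z : hom (X \ox (Y \ox Z)) (X \ox Y \ox Z) :=
  castm (esym (tensA X Y Z)).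
Definition lu X : hom (one \ox X) X := castm (tens1X X).
Definition luV X : hom X (one \ox X) := castm (esym (tens1X X)).
Definition ru X : hom (X \ox one) X := castm (tensX1 X).
Definition ruV X : hom X (X \ox one) := castm (esym (tensX1 X)).

Definition tensmr Y Z X : 'Hom(hom Y Z, hom (Y \ox X) (Z \ox X)) :=
  linfun (fun f => f \om idm X).
Definition tensml X Y Z : 'Hom(hom Y Z, hom (X \ox Y) (X \ox Z)) :=
  linfun (fun f => idm X \om f).

Lemma tensmrE Y Z X (f : hom Y Z) : tensmr Y Z X f = f \om idm X.
Proof. by rewrite linfun_linE //; exact: tensm_linl. Qed.

Lemma tensmlE X Y Z (f : hom Y Z) : tensml X Y Z f = idm X \om f.
Proof. by rewrite linfun_linE //; exact: tensm_linr. Qed.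

End MonoidalCasts.

(** * Rigidity *)

Section DualMorphisms.
Variables (k : fieldType) (C : monCat k).

Section Left.
Variables (d : C -> C)
  (ev : forall X, hom (d X \ox X) one) (coev : forall X, hom one (X \ox d X)).

Definition left_duality : Prop := forall X : C,
  (ru X \oc (idm X \om ev X) \oc asso X (d X) X \oc (coev X \om idm X)
     \oc luV X = idm X) /\
  (lu (d X) \oc (ev X \om idm (d X)) \oc assoV (d X) X (d X)
     \oc (idm (d X) \om coev X) \oc ruV (d X) = idm (d X)).

Definition ldualm X Y (f : hom X Y) : hom (d Y) (d X) :=
  lu (d X) \oc (ev Y \om idm (d X)) \oc assoV (d Y) Y (d X)
    \oc (idm (d Y) \om (f \om idm (d X)))
    \oc (idm (d Y) \om coev X) \oc ruV (d Y).

(* The evaluation at X \ox Y built from those at X and Y; the canonical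
   isomorphism d Y \ox d X -> d (X \ox Y) is the morphism transforming it into
   [ev (X \ox Y)]. *)
Definition ev_tens X Y : hom (d Y \ox d X \ox (X \ox Y)) one :=
  ev Y \oc (idm (d Y) \om (lu Y \oc (ev X \om idm Y) \oc assoV (d X) X Y))
    \oc asso (d Y) (d X) (X \ox Y).

(* The canonical monoidal structure of the left duality functor is given by
   identities. *)
Definition left_duality_strict (dM : forall X Y, d Y \ox d X = d (X \ox Y))
    (d1 : one = d one) : Prop :=
  (forall X Y, ev (X \ox Y) \oc (castm (dM X Y) \om idm (X \ox Y))
                 = ev_tens X Y) /\
  ev one \oc (castm d1 \om idm one) = lu one.

End Left.

Section Right.
Variables (d : C -> C)
  (ev : forall X, hom (X \ox d X) one) (coev : forall X, hom one (d X \ox X)).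

Definition right_duality : Prop := forall X : C,
  (lu X \oc (ev X \om idm X) \oc assoV X (d X) X \oc (idm X \om coev X)
     \oc ruV X = idm X) /\
  (ru (d X) \oc (idm (d X) \om ev X) \oc asso (d X) X (d X)
     \oc (coev X \om idm (d X)) \oc luV (d X) = idm (d X)).

Definition rdualm X Y (f : hom X Y) : hom (d Y) (d X) :=
  ru (d X) \oc (idm (d X) \om ev Y) \oc asso (d X) Y (d Y)
    \oc ((idm (d X) \om f) \om idm (d Y))
    \oc (coev X \om idm (d Y)) \oc luV (d Y).

Definition evr_tens X Y : hom (X \ox Y \ox (d Y \ox d X)) one :=
  ev X \oc (idm X \om (lu (d X) \oc (ev Y \om idm (d X))
                         \oc assoV Y (d Y) (d X)))
    \oc asso X Y (d Y \ox d X).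

Definition right_duality_strict (dM : forall X Y, d Y \ox d X = d (X \ox Y))
    (d1 : one = d one) : Prop :=
  (forall X Y, ev (X \ox Y) \oc (idm (X \ox Y) \om castm (dM X Y))
                 = evr_tens X Y) /\
  ev one \oc (idm one \om castm d1) = lu one.

End Right.
End DualMorphisms.

(* [X^l] is the left dual of X (usually X followed by a star), [X^r] is its
   right dual (usually X preceded by a star). *)
Record rigidCat (k : fieldType) := RigidCat {
  rcat :> monCat k;
  ldual : rcat -> rcat;
  ev : forall X, hom (ldual X \ox X) one;
  coev : forall X, hom one (X \ox ldual X);
  ldualP : left_duality ev coev;
  rdual : rcat -> rcat;
  evr : forall X, hom (X \ox rdual X) one;
  coevr : forall X, hom one (rdual X \ox X);
  rdualP : right_duality evr coevr;
  ldualM : forall X Y, ldual Y \ox ldual X = ldual (X \ox Y);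
  ldual1 : one = ldual one;
  ldual_strict : left_duality_strict ev ldualM ldual1;
  rdualM : forall X Y, rdual Y \ox rdual X = rdual (X \ox Y);
  rdual1 : one = rdual one;
  rdual_strict : right_duality_strict evr rdualM rdual1;
  ldualK : forall X, rdual (ldual X) = X;
  rdualK : forall X, ldual (rdual X) = X;
  ldualmK : forall X Y (f : hom X Y),
    castm (ldualK Y) \oc rdualm evr coevr (ldualm ev coev f)
      = f \oc castm (ldualK X);
  rdualmK : forall X Y (f : hom X Y),
    castm (rdualK Y) \oc ldualm ev coev (rdualm evr coevr f)
      = f \oc castm (rdualK X)
}.

Notation "X ^l" := (ldual X) : tc_scope.
Notation "X ^r" := (rdual X) : tc_scope.

Record finTensCat (k : fieldType) := FinTensCat {
  ftcat :> rigidCat k;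
  ftc_finite_abelian : finite_abelian ftcat;
  ftc_simple_one : simple_object (one : ftcat)
}.

(** * Pivotal structures *)

Section Rigid.
Variables (k : fieldType) (C : rigidCat k).
Implicit Types X Y Z M N : C.

Definition bidualm X Y (f : hom X Y) : hom X^l^l Y^l^l :=
  ldualm (@ev _ C) (@coev _ C) (ldualm (@ev _ C) (@coev _ C) f).

Definition bidualM X Y : X^l^l \ox Y^l^l = (X \ox Y)^l^l :=
  etrans (ldualM Y^l X^l) (congr1 (@ldual k C) (ldualM X Y)).

Definition bidual1 : (one : C) = one^l^l :=
  etrans (ldual1 C) (congr1 (@ldual k C) (ldual1 C)).

Definition birdualK X : X^r^r^l^l = X :=
  etrans (congr1 (@ldual k C) (rdualK X^r)) (rdualK X).

End Rigid.

Record pivotal (k : fieldType) (C : rigidCat k) := Pivotal {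
  piv : forall X : C, hom X X^l^l;
  pivV : forall X : C, hom X^l^l X;
  pivK : forall X, inverse (piv X) (pivV X);
  piv_natural : forall X Y (f : hom X Y),
    piv Y \oc f = bidualm f \oc piv X;
  piv_tens : forall X Y,
    piv (X \ox Y) = castm (bidualM X Y) \oc (piv X \om piv Y);
  piv_one : piv one = castm (bidual1 C)
}.

Section Closing.
Variables (k : fieldType) (C : rigidCat k).
Implicit Types X M N P Q : C.

Definition piv_birdual (p : pivotal C) X : hom X^r^r X :=
  castm (birdualK X) \oc piv p X^r^r.

Definition clr M N X (f : hom (M \ox X) (N \ox X^l^l)) : hom M N :=
  ru N \oc (idm N \om ev X^l) \oc asso N X^l^l X^l
    \oc (f \om idm X^l)
    \oc assoV M X X^l \oc (idm M \om coev X) \oc ruV M.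

Definition cll X M N (f : hom (X \ox M) (X^r^r \ox N)) : hom M N :=
  lu N \oc (evr X^r \om idm N) \oc assoV X^r X^r^r N
    \oc (idm X^r \om f)
    \oc asso X^r X M \oc (coevr X \om idm M) \oc luV M.

Definition clrm M N X : 'Hom(hom (M \ox X) (N \ox X^l^l), hom M N) :=
  linfun (@clr M N X).
Definition cllm X M N : 'Hom(hom (X \ox M) (X^r^r \ox N), hom M N) :=
  linfun (@cll X M N).

Lemma clrmE M N X f : clrm M N X f = clr f.
Proof.
rewrite linfun_linE // => a g h; rewrite /clr.
by rewrite tensm_linl comp_linr !comp_linl.
Qed.

Lemma cllmE X M N f : cllm X M N f = cll f.
Proof.
rewrite linfun_linE // => a g h; rewrite /cll.
by rewrite tensm_linr comp_linr !comp_linl.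
Qed.

End Closing.

(** * Modified traces *)

(* P \ox X and X \ox P are automatically projective when P is; the hypotheses
   [hPX] and [hXP] below only serve to index the trace. *)
Record modified_trace (k : fieldType) (C : rigidCat k) (p : pivotal C)
    (t : forall P : C, projective P -> 'Hom(hom P P, k^o)) : Prop :=
  ModifiedTrace {
    mtr_cyclic : forall (P Q : C) (hP : projective P) (hQ : projective Q)
      (f : hom P Q) (g : hom Q P), t P hP (g \oc f) = t Q hQ (f \oc g);
    mtr_right : forall (P X : C) (hP : projective P)
      (hPX : projective (P \ox X)) (f : hom (P \ox X) (P \ox X^l^l)),
      t P hP (clr f) = t (P \ox X) hPX ((idm P \om pivV p X) \oc f);
    mtr_left : forall (P X : C) (hP : projective P)
      (hXP : projective (X \ox P)) (f : hom (X \ox P) (X^r^r \ox P)),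
      t P hP (cll f) = t (X \ox P) hXP ((piv_birdual p X \om idm P) \oc f)
  }.

Definition has_nonzero_modified_trace (k : fieldType) (C : rigidCat k)
    (p : pivotal C) : Prop :=
  exists2 t : forall P : C, projective P -> 'Hom(hom P P, k^o),
    modified_trace p t
    & exists (P : C) (hP : projective P) (f : hom P P), t P hP f <> 0.

(** * Copowers *)

Definition dualv (k : fieldType) (V : vectType k) : vectType k :=
  'Hom(V, k^o).

Definition dualvm (k : fieldType) (V W : vectType k) (T : 'Hom(V, W)) :
  'Hom(dualv W, dualv V) := linfun (fun phi : 'Hom(W, k^o) => (phi \o T)%VF).

Lemma dualE (k : fieldType) (V W : vectType k) (T : 'Hom(V, W))
  (phi : dualv W) : dualvm T phi = (phi \o T)%VF.
Proof.
by rewrite linfun_linE // => a f g; rewrite comp_lfunDl comp_lfunZl.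
Qed.

(* V . M, with the isomorphism Hom(V . M, N) = Hom_k(V, Hom(M, N)), natural in
   N, that defines it. *)
Record copower (k : fieldType) (C : linCat k) (V : vectType k) (M : C) :=
  Copower {
    cop :> C;
    cop_iso : forall N : C, 'Hom(hom cop N, 'Hom(V, hom M N));
    cop_desc : forall N : C, 'Hom(V, hom M N) -> hom cop N;
    cop_isoK : forall N, cancel (cop_iso N) (@cop_desc N);
    cop_descK : forall N, cancel (@cop_desc N) (cop_iso N);
    cop_natural : forall N N' (g : hom N N') (f : hom cop N),
      cop_iso N' (g \oc f) = (postm M g \o cop_iso N f)%VF
  }.

Section Copowers.
Variables (k : fieldType) (C : linCat k).

Definition cop_in (V : vectType k) (M : C) (c : copower V M) :
  'Hom(V, hom M c) := cop_iso c c (idm c).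

Definition copm (V W : vectType k) (M N : C) (c : copower V M)
    (c' : copower W N) (T : 'Hom(V, W)) (f : hom M N) : hom c c' :=
  cop_desc c (prem c' f \o cop_in c' \o T)%VF.

End Copowers.

Section CopowersTensor.
Variables (k : fieldType) (C : monCat k).

(* The canonical morphisms V . (Z \ox X) -> (V . Z) \ox X and
   V . (X \ox Z) -> X \ox (V . Z); they are invertible when C is rigid. *)
Definition cop_tensr (V : vectType k) (Z X : C) (c : copower V Z)
    (c' : copower V (Z \ox X)) : hom c' (c \ox X) :=
  cop_desc c' (tensmr Z c X \o cop_in c)%VF.

Definition cop_tensl (V : vectType k) (X Z : C) (c : copower V Z)
    (c' : copower V (X \ox Z)) : hom c' (X \ox c) :=
  cop_desc c' (tensml X Z c \o cop_in c)%VF.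

End CopowersTensor.

(** * The Nakayama functor *)

Section Coend.
Variables (k : fieldType) (C : linCat k).
Variable pw : forall (V : vectType k) (M : C), copower V M.

Definition nak_dinatural (M W : C)
    (j : forall Z : C, hom (pw (dualv (hom M Z)) Z) W) : Prop :=
  forall (Z Z' : C) (h : hom Z Z'),
    j Z' \oc copm (pw (dualv (hom M Z')) Z) (pw (dualv (hom M Z')) Z') \1%VF h
    = j Z \oc copm (pw (dualv (hom M Z')) Z) (pw (dualv (hom M Z)) Z)
                (dualvm (postm M h)) (idm Z).

Definition nak_coend (M W : C)
    (i : forall Z : C, hom (pw (dualv (hom M Z)) Z) W) : Prop :=
  nak_dinatural i /\
  forall (W' : C) (j : forall Z : C, hom (pw (dualv (hom M Z)) Z) W'),
    nak_dinatural j -> exists! g : hom W W', forall Z, g \oc i Z = j Z.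

End Coend.

Record nakayama (k : fieldType) (C : linCat k) := Nakayama {
  nak_pw : forall (V : vectType k) (M : C), copower V M;
  nak :> C -> C;
  nak_in : forall Z M : C, hom (nak_pw (dualv (hom M Z)) Z) (nak M);
  nakP : forall M, nak_coend (fun Z => nak_in Z M)
}.

Section Spherical.
Variables (k : fieldType) (C : rigidCat k) (N : nakayama C).

Definition nak_Psi (Psi : forall M X : C, hom (N M \ox X^l^l) (N (M \ox X))) :
    Prop :=
  forall (M X Z : C),
    Psi M X \oc (nak_in N Z M \om idm X^l^l)
      \oc cop_tensr (nak_pw N (dualv (hom M Z)) Z)
                    (nak_pw N (dualv (hom M Z)) (Z \ox X^l^l))
    = nak_in N (Z \ox X^l^l) (M \ox X)
      \oc copm (nak_pw N (dualv (hom M Z)) (Z \ox X^l^l))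
               (nak_pw N (dualv (hom (M \ox X) (Z \ox X^l^l))) (Z \ox X^l^l))
               (dualvm (clrm M Z X)) (idm (Z \ox X^l^l)).

Definition nak_Phi (Phi : forall X M : C, hom (X^r^r \ox N M) (N (X \ox M))) :
    Prop :=
  forall (X M Z : C),
    Phi X M \oc (idm X^r^r \om nak_in N Z M)
      \oc cop_tensl (nak_pw N (dualv (hom M Z)) Z)
                    (nak_pw N (dualv (hom M Z)) (X^r^r \ox Z))
    = nak_in N (X^r^r \ox Z) (X \ox M)
      \oc copm (nak_pw N (dualv (hom M Z)) (X^r^r \ox Z))
               (nak_pw N (dualv (hom (X \ox M) (X^r^r \ox Z))) (X^r^r \ox Z))
               (dualvm (cllm X M Z)) (idm (X^r^r \ox Z)).

Definition nak_unit_cast (X : C) : hom (N (X \ox one)) (N (one \ox X)) :=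
  castm (congr1 N (etrans (tensX1 X) (esym (tens1X X)))).

Definition radford
    (PsiV : forall M X : C, hom (N (M \ox X)) (N M \ox X^l^l))
    (Phi : forall X M : C, hom (X^r^r \ox N M) (N (X \ox M))) (X : C) :
    hom (X^r^r \ox N one) (N one \ox X^l^l) :=
  PsiV one X \oc nak_unit_cast X \oc Phi X one.

End Spherical.

(* The copowers, the coends N, and the isomorphisms Psi and Phi exist in every
   finite tensor category and are unique up to unique isomorphism, so that the
   choices made here are immaterial.  Unimodularity is the existence of f. *)
Definition spherical (k : fieldType) (C : rigidCat k) (p : pivotal C) : Prop :=
  exists (N : nakayama C)
    (Psi : forall M X : C, hom (N M \ox X^l^l) (N (M \ox X)))
    (PsiV : forall M X : C, hom (N (M \ox X)) (N M \ox X^l^l))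
    (Phi : forall X M : C, hom (X^r^r \ox N M) (N (X \ox M))),
  [/\ nak_Psi Psi, forall M X, inverse (Psi M X) (PsiV M X),
      nak_Phi Phi, forall X M, isom (Phi X M)
    & exists2 f : hom one (N one), isom f
      & forall X : C,
        radford PsiV Phi X \oc (idm X^r^r \om f) \oc ruV X^r^r
        = (f \om idm X^l^l) \oc luV X^l^l \oc piv p X \oc piv_birdual p X].

(* Main.v *)
(* From a trace to sphericality.  A nonzero modified trace t makes the pairings
   (f, u) |-> t_P (f u) between Hom(M, P) and Hom(P, M), P projective, perfect:
   bending objects around reduces this to nonzero morphisms between P and the
   unit object, and those with target 1 are epimorphisms because 1 is simple.
   Hence the identity functor is a Nakayama functor, i_{Z,M}(phi) : Z -> M being
   characterized by t_P (f i(phi) z) = phi (z f), and the partial trace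
   properties say that Psi = id (x) p^-1 and Phi = q (x) id, where
   q_X : X^rr -> X comes from the pivotal structure.  The Radford isomorphism is
   then p_X q_X and f = id shows that C is spherical.

   From sphericality to a trace.  For R projective, i_{R,1} is a bijection
   Hom(1, R)^* -> Hom(R, N 1), so that f : 1 -> N 1 yields a pairing <a, b> of
   a : R -> 1 with b : 1 -> R, natural in R.  Then
   t_P g = <ev~_P, (g (x) id) coev_P>, where ev~_P : P (x) P^l ->
     1 is built with
   p_P, is cyclic and has the right partial trace property.  It is the
   functional that i_{P,P} sends to Psi (f (x) p_P), while its mirror image,
     which
   has the left partial trace property, is sent to Phi (q_P^-1 (x) f); these
   agree when C is spherical.

   Left-handed statements are right-handed ones for the reversed tensor
   product. *)

From mathcomp Require Import all_boot all_algebra all_field.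
From Stdlib Require Import ClassicalEpsilon.
Require Import Defs.

Set Implicit Arguments.
Unset Strict Implicit.
Unset Printing Implicit Defensive.

Import GRing.Theory.
Local Open Scope ring_scope.
Local Open Scope tc_scope.

(** Choice: witnesses found pointwise are gathered into functions, whose linearity is then deduced
    from a uniqueness property. *)
Lemma ex_fun (I : Type) (T : I -> Type) (R : forall i, T i -> Prop) :
  (forall i, exists t, R i t) -> exists f : forall i, T i, forall i, R i (f i).
Proof.
move=> ex; exists (fun i =>
  sval (constructive_indefinite_description _ (ex i))).
by move=> i; case: (constructive_indefinite_description _ _).
Qed.

(** * Linear functionals and perfect pairings *)

Section Functionals.
Variable k : fieldType.
Implicit Types U V W : vectType k.

Lemma functional_neq0 V (v : V) : v <> 0 -> exists th : 'Hom(V, k^o), th v <> 0.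
Proof.
move=> v_neq0; apply: NNPP => no_th; apply: v_neq0.
rewrite (coord_vbasis (memvf v)) big1 // => i _.
have [->|ci] := eqVneq (coord (vbasis fullv) i v) 0; first by rewrite scale0r.
case: no_th; exists (linfun (coord (vbasis fullv) i : V -> k^o)).
by rewrite lfunE; apply/eqP.
Qed.

Lemma sub_lfunE U V (f g : 'Hom(U, V)) u : (f - g) u = f u - g u.
Proof. by rewrite add_lfunE opp_lfunE. Qed.

(** A vector [v] outside the image has a nonzero component [w] off the image; a functional that is
    nonzero on [w], composed with the complementary projection, kills the image but not [v]. *)
Lemma functional_separation U V (T : 'Hom(U, V)) :
  (forall th : 'Hom(V, k^o), (forall u, th (T u) = 0) -> th = 0) ->
  forall v, exists u, T u = v.
Proof.
move=> sepT v; apply: NNPP => no_u.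
pose w := v - projv (limg T) v.
have /functional_neq0[th thw] : w <> 0.
  move=> /eqP; rewrite subr_eq0 => /eqP v_eq; apply: no_u.
  have : v \in limg T by rewrite v_eq memv_proj.
  by case/memv_imgP => u _ ->; exists u.
apply: thw; pose th' := (th \o (\1 - projv (limg T)))%VF.
suff th'0 : th' = 0.
  have -> : th w = th' v by rewrite comp_lfunE sub_lfunE id_lfunE.
  by rewrite th'0 lfunE.
apply: sepT => u; rewrite comp_lfunE sub_lfunE id_lfunE projv_id ?subrr ?linear0
  //.
exact: memv_img (memvf _).
Qed.

Lemma dualv_lincombE V c (phi psi : dualv V) (v : V) :
  (c *: phi + psi : 'Hom(V, k^o)) v =
  c * (phi : 'Hom(V, k^o)) v + (psi : 'Hom(V, k^o)) v.
Proof. by rewrite add_lfunE scale_lfunE. Qed.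

Lemma dim_dualv V : \dim (fullv : {vspace dualv V}) = \dim (fullv : {vspace V}).
Proof. by rewrite !dimvf /dim /= muln1. Qed.

Lemma lker0_of_inj U V (T : 'Hom(U, V)) :
  (forall u, T u = 0 -> u = 0) -> lker T == 0%VS.
Proof.
move=> injT; apply/eqP/vspaceP => u; rewrite memv_ker memv0.
by apply/eqP/eqP => [/injT|->] //; rewrite linear0.
Qed.

(** Injectivity of [B] and of its transpose [B'] bounds each dimension by the other, so the
    injective map [B] is onto. *)
Lemma perfect_pairing U V (B : 'Hom(U, dualv V)) :
  (forall u, B u = 0 -> u = 0) ->
  (forall v, (forall u, (B u : 'Hom(V, k^o)) v = 0) -> v = 0) ->
  forall phi, exists u, B u = phi.
Proof.
move=> injU injV.
pose B' : 'Hom(V, dualv U) :=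
  linfun (fun v => linfun (fun u => (B u : 'Hom(V, k^o)) v)).
have B'E v u : (B' v : 'Hom(U, k^o)) u = (B u : 'Hom(V, k^o)) v.
  have lin w : linear (fun u => (B u : 'Hom(V, k^o)) w).
    by move=> a x y; rewrite linearP lfunE /= lfunE.
  rewrite /B' linfun_linE; first by rewrite linfun_linE.
  move=> a x y; apply/lfunP => z.
  by rewrite lfunE /= lfunE /= !linfun_linE // linearP.
have injB' v : B' v = 0 -> v = 0.
  by move=> Bv0; apply: injV => u; rewrite -B'E Bv0 lfunE.
have dimB := limg_dim_eq (f := B) (U := fullv).
have dimB' := limg_dim_eq (f := B') (U := fullv).
rewrite (eqP (lker0_of_inj injU)) capv0 in dimB.
rewrite (eqP (lker0_of_inj injB')) capv0 in dimB'.
have limgB : limg B = fullv.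
  apply/eqP; rewrite eqEdim subvf dimB // (dim_dualv V).
  by rewrite -(dim_dualv U) -(dimB' erefl) dimvS // subvf.
move=> phi; have := memvf phi; rewrite -limgB => /memv_imgP[u _ ->].
by exists u.
Qed.

End Functionals.

(** * Linearity of composition; monos and epis tested on zero composites *)

Section LinCat.
Variables (k : fieldType) (C : linCat k).
Implicit Types X Y Z : C.

Lemma compDl X Y Z (f g : hom Y Z) (h : hom X Y) : (f + g) \oc h =
  (f \oc h) + (g \oc h).
Proof. by rewrite -!premE raddfD. Qed.
Lemma compBl X Y Z (f g : hom Y Z) (h : hom X Y) : (f - g) \oc h =
  (f \oc h) - (g \oc h).
Proof. by rewrite -!premE raddfB. Qed.
Lemma compBr X Y Z (h : hom Y Z) (f g : hom X Y) : h \oc (f - g) =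
  (h \oc f) - (h \oc g).
Proof. by rewrite -!postmE raddfB. Qed.
Lemma comp0l X Y Z (h : hom X Y) : (0 : hom Y Z) \oc h = 0.
Proof. by rewrite -!premE raddf0. Qed.
Lemma comp0r X Y Z (h : hom Y Z) : h \oc (0 : hom X Y) = 0.
Proof. by rewrite -!postmE raddf0. Qed.
Lemma compZl X Y Z a (f : hom Y Z) (h : hom X Y) : (a *: f) \oc h =
  a *: (f \oc h).
Proof. by rewrite -!premE linearZ. Qed.
Lemma compZr X Y Z a (h : hom Y Z) (f : hom X Y) : h \oc (a *: f) =
  a *: (h \oc f).
Proof. by rewrite -!postmE linearZ. Qed.
Lemma comp_suml I (r : seq I) X Y Z (F : I -> hom Y Z) (h : hom X Y) :
  (\sum_(i <- r) F i) \oc h = \sum_(i <- r) (F i \oc h).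
Proof. by rewrite -premE linear_sum; apply: eq_bigr => i _; exact: premE. Qed.
Lemma comp_sumr I (r : seq I) X Y Z (h : hom Y Z) (F : I -> hom X Y) :
  h \oc (\sum_(i <- r) F i) = \sum_(i <- r) (h \oc F i).
Proof. by rewrite -postmE linear_sum; apply: eq_bigr => i _; exact: postmE. Qed.

Lemma mono_eq0 X Y (f : hom X Y) :
  (forall Z (g : hom Z X), f \oc g = 0 -> g = 0) -> mono f.
Proof.
move=> ker0 Z g h fgh; apply/eqP; rewrite -subr_eq0; apply/eqP/ker0.
by rewrite compBr fgh subrr.
Qed.

Lemma epi_eq0 X Y (f : hom X Y) :
  (forall Z (g : hom Y Z), g \oc f = 0 -> g = 0) -> epi f.
Proof.
move=> ker0 Z g h fgh; apply/eqP; rewrite -subr_eq0; apply/eqP/ker0.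
by rewrite compBl fgh subrr.
Qed.

Lemma projective_retract X P (s : hom X P) (r : hom P X) :
  r \oc s = idm X -> projective P -> projective X.
Proof.
move=> rs projP Y Z e f epi_e; have [g eg] := projP _ _ e (f \oc r) epi_e.
by exists (g \oc s); rewrite compA eg -compA rs compm1.
Qed.

End LinCat.

(** * Equivalences, and kernels and powers of modules *)

Section FiniteAbelian.
Variables (k : fieldType) (A : falgType k).

(** Naturality of [eta] makes [F] faithful, and that of [eps] makes [G] faithful. A morphism [g] is
    lifted by conjugating [fmap G g] with [eta]; the lift is correct because [G] is faithful. *)
Lemma equivalence_ff (C D : linCat k) : equivalent C D ->
  exists F : functor C D,
  [/\ forall X Y (f g : hom X Y), fmap F X Y f = fmap F X Y g -> f = g,
      forall X Y (g : hom (F X) (F Y)), exists f, fmap F X Y f = g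
    & forall V : D, exists (Z : C) (i : hom (F Z) V), isom i].
Proof.
case=> F [G [eta [eps [eta_iso eps_iso eta_nat eps_nat]]]]; exists F.
have faithF X Y (f g : hom X Y) : fmap F X Y f = fmap F X Y g -> f = g.
  move=> Ffg; have [eta' [eta'K _]] := eta_iso Y.
  have : eta Y \oc f = eta Y \oc g by rewrite !eta_nat Ffg.
  by move/(congr1 (comp eta')); rewrite !compA eta'K !comp1m.
have faithG X Y (f g : hom X Y) : fmap G X Y f = fmap G X Y g -> f = g.
  move=> Gfg; have [eps' [_ eps'K]] := eps_iso X.
  have : f \oc eps X = g \oc eps X by rewrite -!eps_nat Gfg.
  by move/(congr1 (fun h => h \oc eps')); rewrite -!compA eps'K !compm1.
split=> // [X Y g | V].
  have [eta' [eta'K etaK']] := eta_iso Y.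
  have [etaX' [_ etaXK']] := eta_iso X.
  exists (eta' \oc fmap G _ _ g \oc eta X); apply: faithG.
  have := eta_nat _ _ (eta' \oc fmap G _ _ g \oc eta X).
  rewrite !compA etaK' comp1m => /(congr1 (fun h => h \oc etaX')).
  by rewrite -!compA etaXK' !compm1 => <-.
by exists (G V), (eps V).
Qed.

Implicit Types V W : modCat A.

Lemma modhom_act V W (f : hom V W) a v :
  vsval f (act V a v) = act W a (vsval f v).
Proof. exact: (modhomP _ (subvsP f)). Qed.

Lemma modhom_compE (U V W : modCat A) (g : hom V W) (f : hom U V) v :
  vsval (g \oc f) v = vsval g (vsval f v).
Proof. by rewrite comp_lfunE. Qed.

Lemma modhom_idE V v : vsval (idm V) v = v.
Proof. by rewrite id_lfunE. Qed.

Lemma modhom0E V W v : vsval (0 : hom V W) v = 0.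
Proof. exact: zero_lfunE. Qed.

Lemma modhom_eq V W (f g : hom V W) : (forall v, vsval f v = vsval g v) ->
  f = g.
Proof. by move=> fg; apply/val_inj/lfunP. Qed.

Lemma modhom_ex V W (f : car V -> car W) : linear f ->
  (forall a v, f (act V a v) = act W a (f v)) ->
  exists h : hom V W, forall v, vsval h v = f v.
Proof.
move=> f_lin f_act.
have fP : linfun f \in modhom V W.
  by apply/modhomP => a v; rewrite !linfun_linE.
by exists (Subvs fP) => v; rewrite /= linfun_linE.
Qed.

Definition regmod_act : 'Hom(A, 'End(A)) := linfun (fun a => linfun ( *%R a)).

Lemma regmod_actE a b : regmod_act a b = a * b.
Proof.
have lin x : linear ( *%R x : A -> A).
  by move=> c y z; rewrite mulrDr scalerAr.
rewrite /regmod_act linfun_linE ?linfun_linE // => c x y; apply/lfunP => z.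
by rewrite add_lfunE scale_lfunE !linfun_linE // mulrDl scalerAl.
Qed.

Definition regmod : modCat A.
Proof.
refine (@FdMod k A A regmod_act _ _).
- by apply/lfunP => b; rewrite regmod_actE mul1r lfunE.
- by move=> a b; apply/lfunP => c; rewrite comp_lfunE !regmod_actE mulrA.
Defined.

(** The transpose of right multiplication, which makes the dual of [A] a left module. Morphisms from
    [V] to it correspond to linear functionals on [V], by evaluation at 1. *)
Definition coregmod_act : 'Hom(A, 'End(dualv A)) :=
  linfun (fun a => linfun (fun phi : dualv A =>
    linfun (fun b => (phi : 'Hom(A, k^o)) (b * a)) : dualv A)).

Lemma coregmod_actE a (phi : dualv A) b : (coregmod_act a phi : 'Hom(A,
  k^o)) b = (phi : 'Hom(A, k^o)) (b * a).
Proof.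
have lin1 x (psi : 'Hom(A, k^o)) : linear (fun b => psi (b * x)).
  by move=> c y z; rewrite mulrDl linearD /= -scalerAl linearZ.
have lin2 x : linear (fun psi : dualv A =>
    linfun (fun b => (psi : 'Hom(A, k^o)) (b * x)) : dualv A).
  move=> c y z; apply/lfunP => t;
    apply: etrans _ (esym (dualv_lincombE c _ _ t)).
  by rewrite !(linfun_linE (lin1 x _)); exact: dualv_lincombE.
rewrite /coregmod_act linfun_linE => [|c x y].
  by rewrite (linfun_linE (lin2 a)) (linfun_linE (lin1 _ _)).
apply/lfunP => psi; rewrite add_lfunE scale_lfunE !(linfun_linE (lin2 _)).
apply/lfunP => t; apply: etrans _ (esym (dualv_lincombE c _ _ t)).
by rewrite !(linfun_linE (lin1 _ _)) mulrDr -scalerAr linearP.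
Qed.

Definition coregmod : modCat A.
Proof.
refine (@FdMod k A (dualv A) coregmod_act _ _).
- by apply/lfunP => phi; apply/lfunP => b; rewrite coregmod_actE mulr1 lfunE.
- move=> a b; apply/lfunP => phi; apply/lfunP => c.
  by rewrite comp_lfunE !coregmod_actE mulrA.
Defined.

Lemma modcat_kernel V W (f : hom V W) : exists (K : modCat A) (i : hom K V),
  [/\ f \oc i = 0, mono i
    & forall U (g : hom U V), f \oc g = 0 -> exists h, i \oc h = g].
Proof.
pose S := lker (vsval f).
have actS a (v : subvs_of S) : act V a (vsval v) \in S.
  have fv0 : vsval f (vsval v) = 0 by apply/eqP; rewrite -memv_ker subvsP.
  by rewrite memv_ker modhom_act fv0 linear0.
pose aS : 'Hom(A, 'End(subvs_of S)) :=
  linfun (fun a => linfun (fun v : subvs_of S => vsproj S (act V a (vsval v)))).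
have aSE a v : vsval (aS a v) = act V a (vsval v).
  have lin1 b : linear (fun v : subvs_of S => vsproj S (act V b (vsval v))).
    by move=> c x y; rewrite !linearP.
  rewrite /aS linfun_linE; first by rewrite linfun_linE // vsprojK.
  move=> c x y; apply/lfunP => z; rewrite add_lfunE scale_lfunE.
  by rewrite !linfun_linE // linearP add_lfunE scale_lfunE linearP.
have aS1 : aS 1 = \1%VF.
  by apply/lfunP => v; apply: val_inj; rewrite /= aSE act1 !lfunE.
have aSM a b : aS (a * b) = (aS a \o aS b)%VF.
  by apply/lfunP => v; apply: val_inj;
    rewrite comp_lfunE /= !aSE actM comp_lfunE.
pose K : modCat A := @FdMod k A (subvs_of S) aS aS1 aSM.
have [||i iE] := @modhom_ex K V (fun v : subvs_of S => vsval v).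
- by move=> c x y; rewrite linearP.
- exact: aSE.
exists K, i; split.
- apply: modhom_eq => v; rewrite modhom_compE iE modhom0E.
  by apply/eqP; rewrite -memv_ker; exact: subvsP.
- apply: mono_eq0 => Z g ig0; apply: modhom_eq => v; apply: val_inj.
  have := congr1 (fun h : hom Z V => vsval h v) ig0.
  by rewrite modhom_compE iE !modhom0E.
- move=> U g fg0.
  have gS v : vsval g v \in S.
    by rewrite memv_ker -modhom_compE fg0 modhom0E.
  have [||h hE] := @modhom_ex U K (fun v => vsproj S (vsval g v)).
  + by move=> c x y; rewrite !linearP.
  + move=> a v; apply: val_inj; rewrite /= aSE vsprojK //.
    by rewrite vsprojK // modhom_act.
  exists h; apply: modhom_eq => v; rewrite modhom_compE iE hE vsprojK //.
Qed.

(** The direct sum of [n] copies of [M], in equational form so that it can be carried along an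
    equivalence. *)
Definition is_power (C : linCat k) (n : nat) (M S : C)
  (i_ : 'I_n -> hom M S) (p_ : 'I_n -> hom S M) :=
  (forall i j, p_ i \oc i_ j = (if i == j then idm M else 0)) /\
  \sum_i (i_ i \oc p_ i) = idm S.

Lemma modcat_power n V : exists (S : modCat A) (i_ : 'I_n -> hom V S)
  (p_ : 'I_n -> hom S V), is_power i_ p_.
Proof.
pose T : vectType k := {ffun 'I_n -> car V}.
pose aT : 'Hom(A, 'End(T)) :=
  linfun (fun a => linfun (fun v : T => [ffun i => act V a (v i)] : T)).
have aTE a (v : T) i : (aT a v : {ffun 'I_n -> car V}) i = act V a (v i).
  have lin1 b : linear (fun v : T => [ffun i => act V b (v i)] : T).
    by move=> c x y; apply/ffunP => j; rewrite !ffunE linearP.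
  rewrite /aT linfun_linE; first by rewrite linfun_linE // ffunE.
  move=> c x y; apply/lfunP => z; rewrite add_lfunE scale_lfunE.
  by rewrite !linfun_linE //; apply/ffunP => j;
    rewrite !ffunE linearP add_lfunE scale_lfunE.
have aT1 : aT 1 = \1%VF.
  by apply/lfunP => v; apply/ffunP => i; rewrite aTE act1 !lfunE.
have aTM a b : aT (a * b) = (aT a \o aT b)%VF.
  by apply/lfunP => v; apply/ffunP => i;
    rewrite comp_lfunE !aTE actM comp_lfunE.
pose S : modCat A := @FdMod k A T aT aT1 aTM.
have i_ex (j : 'I_n) :
    exists h : hom V S, forall v : car V, vsval h v =
      ([ffun i => if i == j then v else 0] : T).
  apply: (@modhom_ex V S).
  - move=> c x y; apply/ffunP => l; rewrite !ffunE.
    by case: (l == j); rewrite // scaler0 addr0.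
  - move=> a v; apply/ffunP => l; rewrite aTE !ffunE.
    by case: (l == j); rewrite // linear0.
have p_ex (j : 'I_n) :
    exists h : hom S V, forall v : T, vsval h v = v j.
  apply: (@modhom_ex S V).
  - by move=> c x y; rewrite !ffunE.
  - by move=> a v; rewrite /= aTE.
have [i_ i_E] := ex_fun i_ex; have [p_ p_E] := ex_fun p_ex.
exists S, i_, p_; split.
- move=> i j; apply: modhom_eq => v; rewrite modhom_compE.
  rewrite p_E i_E ffunE.
  by case: (i == j); rewrite ?modhom_idE ?modhom0E.
- apply: modhom_eq => v; rewrite modhom_idE.
  rewrite raddf_sum sum_lfunE; apply/ffunP => l; rewrite sum_ffunE.
  rewrite (bigD1 l) //= big1 ?addr0 => [|i il].
    by rewrite comp_lfunE i_E p_E ffunE eqxx.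
  by rewrite comp_lfunE i_E ffunE eq_sym (negPf il).
Qed.

End FiniteAbelian.

(** * Generators and dualizing objects in finite abelian categories *)

Section Generators.
Variables (k : fieldType) (C : linCat k).
Implicit Types X Y Z G I : C.

Definition separating G : Prop :=
  forall X Y (f : hom X Y), (forall z : hom G X, f \oc z = 0) -> f = 0.

(** Fullness of the functor Hom(G, -) into right modules over End(G). *)
Definition dense G : Prop :=
  forall X Y (T : 'Hom(hom G X, hom G Y)),
    (forall (z : hom G X) (e : hom G G), T (z \oc e) = T z \oc e) ->
    exists y : hom X Y, forall z, T z = y \oc z.

(** [I] represents the contravariant functor sending [Z] to the dual of Hom(G, Z), with universal
    element [tau]. For modules over [A], one takes for [G] the regular module, for [I] the dual of
    [A], and for [tau] evaluation at 1. *)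
Definition dualizing G I (tau : 'Hom(hom G I, k^o)) : Prop :=
  (forall Z (phi : 'Hom(hom G Z, k^o)),
     exists x : hom Z I, forall z, tau (x \oc z) = phi z) /\
  (forall Z (x : hom Z I), (forall z, tau (x \oc z) = 0) -> x = 0).

Lemma separating_eq G : separating G ->
  forall X Y (f g : hom X Y), (forall z : hom G X, f \oc z = g \oc z) -> f = g.
Proof.
move=> sepG X Y f g fg; apply/eqP; rewrite -subr_eq0; apply/eqP/sepG => z.
by rewrite compBl fg subrr.
Qed.

(** A functional on Hom(G, Y) that vanishes on everything factoring through [e] has the form
    [tau (x \oc -)] with [x \oc e = 0], hence is zero as [e] is epi. Separation by functionals then
    gives the lifts. *)
Lemma dualizing_projective G I tau : @dualizing G I tau -> projective G.
Proof.
case=> tau_ex tau_inj X Y e f epi_e.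
have [|z ez] := functional_separation (T := postm G e) _ f; last first.
  by exists z; rewrite -ez postmE.
move=> th th0; have [x xE] := tau_ex Y th.
apply/lfunP => z; rewrite -xE lfunE /=.
suff -> : x = 0 by rewrite comp0l linear0.
apply: epi_e; rewrite comp0l; apply: tau_inj => {}z.
by rewrite -compA xE -postmE th0.
Qed.

End Generators.

Section FiniteAbelianConsequences.
Variables (k : fieldType) (C : linCat k).
Hypothesis finC : finite_abelian C.

Lemma finite_abelian_kernel (X Y : C) (f : hom X Y) :
  exists (K : C) (i : hom K X), [/\ f \oc i = 0, mono i
    & forall U (g : hom U X), f \oc g = 0 -> exists h, i \oc h = g].
Proof.
have [A /equivalence_ff[F [faithF fullF surjF]]] := finC.
have [K [i [fi0 mono_i kerP]]] := modcat_kernel (fmap F _ _ f).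
have [Z [j [j' [j'K jK']]]] := surjF K.
have [m mE] := fullF _ _ (i \oc j).
exists Z, m; split.
- by apply: faithF; rewrite fmapM mE compA fi0 comp0l linear0.
- move=> U g h mgh; apply: faithF.
  have : i \oc (j \oc fmap F _ _ g) = i \oc (j \oc fmap F _ _ h).
    by rewrite !compA -mE -!fmapM mgh.
  by move/mono_i/(congr1 (comp j')); rewrite !compA j'K !comp1m.
- move=> U g fg0.
  have [|h hE] := kerP _ (fmap F _ _ g); first by rewrite -fmapM fg0 linear0.
  have [n nE] := fullF _ _ (j' \oc h).
  exists n; apply: faithF.
  by rewrite fmapM mE nE compA -[i \oc j \oc j']compA jK' compm1.
Qed.

Lemma finite_abelian_power n (M : C) :
  exists (S : C) (i_ : 'I_n -> hom M S) (p_ : 'I_n -> hom S M), is_power i_ p_.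
Proof.
have [A /equivalence_ff[F [faithF fullF surjF]]] := finC.
have [S [i_ [p_ [piE ipE]]]] := modcat_power n (F M).
have [Z [j [j' [j'K jK']]]] := surjF S.
have [m_ mE] := ex_fun (fun l => fullF _ _ (j' \oc i_ l)).
have [q_ qE] := ex_fun (fun l => fullF _ _ (p_ l \oc j)).
exists Z, m_, q_; split.
- move=> l l'; apply: faithF.
  rewrite fmapM qE mE compA -[_ \oc j \oc j']compA jK' compm1 piE.
  by case: (l == l'); rewrite ?fmap1 ?linear0.
- apply: faithF; rewrite linear_sum fmap1 -[idm _]j'K -[j' in RHS]compm1 -ipE.
  rewrite comp_sumr comp_suml; apply: eq_bigr => l _.
  by rewrite [LHS]fmapM mE qE !compA.
Qed.

(** The regular module and its dual are carried back to [C]. Each Hom(G, X) is identified with the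
    underlying space of [F X] through [u], and the three properties are checked on elements. *)
Lemma finite_abelian_generator :
  exists (G I : C) (tau : 'Hom(hom G I, k^o)),
    [/\ separating G, dense G & dualizing tau].
Proof.
have [A /equivalence_ff[F [faithF fullF surjF]]] := finC.
have [G [i [i' [i'K iK']]]] := surjF (regmod A).
(* The free generator of [F G]; [u] is evaluation at it. *)
pose w : car (F G) := vsval i' 1.
pose u (X : C) : 'Hom(hom G X, car (F X)) :=
  linfun (fun z => vsval (fmap F G X z) w).
have uE X z : u X z = vsval (fmap F G X z) w.
  by rewrite /u linfun_linE // => a x y; rewrite !linearP add_lfunE scale_lfunE.
have uM X Y (y : hom X Y) z : u Y (y \oc z) = vsval (fmap F _ _ y) (u X z).
  by rewrite !uE fmapM modhom_compE.
have u_inj X z : u X z = 0 -> z = 0.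
  move=> uz0; apply: faithF; rewrite linear0 -[fmap F _ _ z]compm1 -i'K compA.
  suff -> : fmap F _ _ z \oc i' = 0 by rewrite comp0l.
  apply: modhom_eq => b; rewrite modhom0E modhom_compE.
  have -> : b = act (regmod A) b 1 by rewrite [RHS]regmod_actE mulr1.
  by rewrite !modhom_act -uE uz0 linear0.
have u_surj X v : exists z, u X z = v.
  have [||h hE] := @modhom_ex _ _ (regmod A) (F X) (fun b => act (F X) b v).
  - by move=> a x y; rewrite linearP add_lfunE scale_lfunE.
  - by move=> a b; rewrite [act (regmod A) a b]regmod_actE actM comp_lfunE.
  have [z zE] := fullF _ _ (h \oc i); exists z.
  rewrite uE zE /w -modhom_compE -compA iK' compm1 hE act1.
  by rewrite id_lfunE.
have u_injE X z z' : u X z = u X z' -> z = z'.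
  by move=> uzz'; apply/eqP; rewrite -subr_eq0; apply/eqP/u_inj;
    rewrite linearB /= uzz' subrr.
have uV X : exists v : car (F X) -> hom G X,
    [/\ linear v, forall x, u X (v x) = x & forall z, v (u X z) = z].
  have [v vE] := ex_fun (u_surj X); exists v; split=> // [a x y | z].
    by apply: u_injE; rewrite linearP /= !vE.
  by apply: u_injE; rewrite vE.
(* Through [u], the action of [A] on modules becomes precomposition with endomorphisms of [G]. *)
have right_mul a : exists e : hom G G, forall X z, u X (z \oc e) =
  act (F X) a (u X z).
  have [e eE] := u_surj G (act (F G) a (u G (idm G))); exists e => X z.
  by rewrite uM eE modhom_act -uM compm1.
have [Z [j [j' [j'K jK']]]] := surjF (coregmod A).
pose tau : 'Hom(hom G Z, k^o) :=
  linfun (fun x => (vsval j (u Z x) : 'Hom(A, k^o)) 1).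
have tauE x : tau x = (vsval j (u Z x) : 'Hom(A, k^o)) 1.
  rewrite /tau linfun_linE // => a y z; rewrite !linearP; exact: dualv_lincombE.
exists G, Z, tau; split.
- move=> X Y f f0; apply: faithF; rewrite linear0; apply: modhom_eq => v.
  have [z <-] := u_surj X v.
  by rewrite -uM f0 linear0 modhom0E.
- move=> X Y T TE; have [v [v_lin uvK vuK]] := uV X.
  have [||h hE] := @modhom_ex _ _ (F X) (F Y) (fun x => u Y (T (v x))).
  + by move=> a x y; rewrite v_lin !linearP.
  + move=> a x; have [e eE] := right_mul a.
    by rewrite -eE -TE; congr (u Y (T _)); apply: u_injE; rewrite eE !uvK.
  have [y yE] := fullF _ _ h; exists y => z.
  by apply: u_injE; rewrite uM yE hE vuK.
- split=> [X phi | X x x0].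
  + have [v [v_lin uvK vuK]] := uV X.
    have lin_b (x : car (F X)) : linear (fun b => phi (v (act (F X) b x))).
      by move=> a y z; rewrite !linearP add_lfunE scale_lfunE v_lin linearP.
    have [||h hE] := @modhom_ex _ _ (F X) (coregmod A)
      (fun x => linfun (fun b => phi (v (act (F X) b x))) : dualv A).
    * move=> a y z; apply/lfunP => b.
      apply: etrans _ (esym (dualv_lincombE a _ _ b)).
      by rewrite !(linfun_linE (lin_b _)) !linearP v_lin linearP.
    * move=> a y; apply/lfunP => b.
      rewrite [RHS]coregmod_actE !(linfun_linE (lin_b _)).
      by rewrite actM comp_lfunE.
    have [x xE] := fullF _ _ (j' \oc h); exists x => z.
    rewrite tauE uM xE -modhom_compE compA jK' comp1m hE (linfun_linE (lin_b
      _)).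
    by rewrite act1 id_lfunE vuK.
  + apply: faithF; rewrite linear0 -[fmap F _ _ x]comp1m -j'K -compA.
    suff -> : j \oc fmap F _ _ x = 0 by rewrite comp0r.
    apply: modhom_eq => v; rewrite modhom0E; apply/lfunP => a.
    rewrite [RHS]zero_lfunE -[a]mul1r.
    have [e eE] := right_mul a; have [z zE] := u_surj X v.
    have := x0 (z \oc e); rewrite tauE uM eE zE -modhom_compE modhom_act.
    by rewrite [LHS]coregmod_actE.
Qed.

End FiniteAbelianConsequences.

(** * Copowers, and projectives as summands of powers of a generator *)

Section Copower.
Variables (k : fieldType) (C : linCat k) (V : vectType k) (M : C).
Variable c : copower V M.

Lemma cop_isoE N (f : hom c N) v : cop_iso c N f v = f \oc cop_in c v.
Proof.
by rewrite -{1}[f]compm1 cop_natural comp_lfunE postmE.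
Qed.

Lemma cop_descE N (T : 'Hom(V, hom M N)) v : cop_desc c T \oc cop_in c v = T v.
Proof. by rewrite -cop_isoE cop_descK. Qed.

Lemma cop_eq N (f g : hom c N) :
  (forall v, f \oc cop_in c v = g \oc cop_in c v) -> f = g.
Proof.
move=> fg; apply: (can_inj (@cop_isoK _ _ _ _ c N)).
by apply/lfunP => v; apply: etrans (cop_isoE f v) _; rewrite fg (cop_isoE g v).
Qed.

End Copower.

Lemma copm_in (k : fieldType) (C : linCat k) (V W : vectType k) (M N : C)
    (c : copower V M) (c' : copower W N) (T : 'Hom(V, W)) (f : hom M N) v :
  copm c c' T f \oc cop_in c v = cop_in c' (T v) \oc f.
Proof. by rewrite cop_descE !comp_lfunE premE. Qed.

(** [V . M] is a sum of copies of [M] indexed by a basis of [V]: a linear map out of [V] is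
    determined by its values on the basis. *)
Lemma power_copower (k : fieldType) (C : linCat k) (V : vectType k) (M S : C)
    (i_ : 'I_(\dim (fullv : {vspace V})) -> hom M S) p_ :
  is_power i_ p_ -> exists c : copower V M, True.
Proof.
case=> piE ipE; set n := \dim _ in i_ p_ piE ipE *.
pose b : n.-tuple V := vbasis fullv.
pose iso N (f : hom S N) : 'Hom(V, hom M N) :=
  linfun (fun v => \sum_j coord b j v *: (f \oc i_ j)).
have isoE N (f : hom S N) v : iso N f v = \sum_j coord b j v *: (f \oc i_ j).
  rewrite /iso linfun_linE // => a x y.
  rewrite scaler_sumr -big_split /=; apply: eq_bigr => j _.
  by rewrite linearP scalerDl scalerA.
have isoL N : linear (iso N).
  move=> a x y; apply/lfunP => v; rewrite add_lfunE scale_lfunE !isoE.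
  rewrite scaler_sumr -big_split /=; apply: eq_bigr => j _.
  by rewrite compDl compZl scalerDr !scalerA mulrC.
pose desc N (T : 'Hom(V, hom M N)) : hom S N :=
  \sum_(j < n) (T (b`_j) \oc p_ j).
have isoK N : cancel (linfun (iso N)) (desc N).
  move=> f; rewrite linfun_linE // -[RHS]compm1 -ipE comp_sumr.
  apply: eq_bigr => j _; rewrite isoE (bigD1 j) //= big1 => [|l lj].
    by rewrite coord_free ?(basis_free (vbasisP _)) // eqxx scale1r addr0 compA.
  rewrite coord_free ?(basis_free (vbasisP _)) //.
  by rewrite (_ : (_ == _) = false) ?scale0r // eq_sym; apply/negbTE.
have descK N : cancel (desc N) (linfun (iso N)).
  move=> T; rewrite linfun_linE //; apply/lfunP => v; rewrite isoE.
  rewrite [in RHS](coord_vbasis (memvf v)) linear_sum /=; apply: eq_bigr => j _.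
  rewrite linearZ /=; congr (_ *: _); rewrite comp_suml (bigD1 j) //= big1.
    by rewrite -compA piE eqxx compm1 addr0.
  by move=> l lj; rewrite -compA piE (negPf lj) comp0r.
unshelve eexists; first refine (@Copower k C V M S (fun N =>
  linfun (iso N)) desc isoK descK _); last by [].
move=> N N' g f; rewrite !linfun_linE //; apply/lfunP => v.
rewrite comp_lfunE postmE !isoE comp_sumr; apply: eq_bigr => j _.
by rewrite compZr compA.
Qed.

(** A basis of Hom(G, P) assembles into a morphism [e] from a power of [G] to [P]. It is epi because
    [G] separates, and it splits because [P] is projective. *)
Lemma projective_summand (k : fieldType) (C : linCat k) (G P : C) :
  finite_abelian C -> separating G -> projective P ->
  exists n (s_ : 'I_n -> hom P G) (r_ : 'I_n -> hom G P),
    \sum_i (r_ i \oc s_ i) = idm P.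
Proof.
move=> finC sepG projP; pose n := \dim (fullv : {vspace hom G P}).
have [S [i_ [p_ [piE ipE]]]] := finite_abelian_power finC n G.
pose b : n.-tuple (hom G P) := vbasis fullv.
pose e : hom S P := \sum_(j < n) (b`_j \oc p_ j).
have ei j : e \oc i_ j = b`_j.
  rewrite comp_suml (bigD1 j) //= big1 => [|l lj].
    by rewrite -compA piE eqxx compm1 addr0.
  by rewrite -compA piE (negPf lj) comp0r.
have epi_e : epi e.
  apply: epi_eq0 => Z g ge0; apply: sepG => z.
  rewrite (coord_vbasis (memvf z)) comp_sumr big1 // => j _.
  by rewrite compZr -/b -ei compA ge0 comp0l scaler0.
have [s es] := projP _ _ e (idm P) epi_e.
exists n, (fun j => p_ j \oc s), (fun j : 'I_n => b`_j).
by rewrite -[RHS]es comp_suml; apply: eq_bigr => j _; rewrite compA.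
Qed.

(** * Coends, and their components at projective objects *)

Section Coends.
Variables (k : fieldType) (C : linCat k).

(** Copowers are eliminated here: [J Z] is the linear map that corresponds to a morphism from the
    copower of [Z] to [W]. *)
Definition dinatural (M W : C) (J : forall Z : C, 'Hom(dualv (hom M Z),
  hom Z W)) :=
  forall (Z Z' : C) (h : hom Z Z') (phi : dualv (hom M Z')),
    J Z' phi \oc h = J Z (dualvm (postm M h) phi).

Definition coend (M W : C) (J : forall Z : C, 'Hom(dualv (hom M Z), hom Z W)) :=
  dinatural J /\
  forall (W' : C) (J' : forall Z : C, 'Hom(dualv (hom M Z), hom Z W')),
    dinatural J' -> exists! g : hom W W', forall Z phi, g \oc J Z phi =
      J' Z phi.

Variable pw : forall (V : vectType k) (M : C), copower V M.

Lemma nak_dinaturalP M W (j : forall Z : C, hom (pw (dualv (hom M Z)) Z) W) :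
  nak_dinatural j <-> dinatural (fun Z => cop_iso _ _ (j Z)).
Proof.
split=> dinat_j Z Z' h => [phi|].
  have := congr1 (fun f => f \oc cop_in _ phi) (dinat_j Z Z' h).
  by rewrite -!compA !copm_in id_lfunE compm1 compA -!cop_isoE.
apply: cop_eq => phi; have := dinat_j Z Z' h phi.
by rewrite -!compA !copm_in id_lfunE compm1 compA -!cop_isoE.
Qed.

Lemma nak_coendP M W (i : forall Z : C, hom (pw (dualv (hom M Z)) Z) W) :
  nak_coend i <-> coend (fun Z => cop_iso _ _ (i Z)).
Proof.
split=> -[dinat_i univ_i]; split; try exact/nak_dinaturalP.
  move=> W' J dinat_J; have [|g [gi g_uniq]] :=
    univ_i W' (fun Z => cop_desc _ (J Z)).
    apply/nak_dinaturalP => Z Z' h phi.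
    by rewrite !cop_descK.
  exists g; split=> [Z phi | g' g'i].
    by rewrite [in LHS](cop_isoE (i Z)) compA gi cop_descE.
  apply: g_uniq => Z; apply: cop_eq => phi.
  by rewrite cop_descE -compA -cop_isoE g'i.
move=> W' j dinat_j; have [|g [gi g_uniq]] :=
  univ_i W' (fun Z => cop_iso _ _ (j Z)).
  exact/nak_dinaturalP.
exists g; split=> [Z | g' g'i].
  by apply: cop_eq => phi; rewrite -compA -!cop_isoE gi.
by apply: g_uniq => Z phi; rewrite (cop_isoE (i Z)) (cop_isoE (j Z)) compA g'i.
Qed.

End Coends.

Section CoendProjective.
Variables (k : fieldType) (C : linCat k).
Hypothesis finC : finite_abelian C.
Variables (M W : C) (J : forall Z : C, 'Hom(dualv (hom M Z), hom Z W)).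
Hypothesis coendJ : coend J.

(* The pairing with [I] represents the dual of [hom G -], so that morphisms out
   of the coend into [I] are computed by the Yoneda lemma. *)
Lemma coend_generator_bij (G I : C) (tau : 'Hom(hom G I, k^o)) :
  dualizing tau ->
  (forall phi, J G phi = 0 -> phi = 0) /\ (forall h, exists phi, J G phi = h).
Proof.
case=> tau_ex tau_inj; have [dinatJ univJ] := coendJ; split.
- move=> phi Jphi0; apply/lfunP => f; rewrite [RHS]zero_lfunE.
  (* To recover [phi f], each [psi] is sent to the morphism into [I] representing [psi (- \oc f)].
     This family is dinatural, so it factors through the coend and vanishes at [phi] together with
     [J G phi]. *)
  have ex_j Z (psi : dualv (hom M Z)) : exists x : hom Z I,
      forall z, tau (x \oc z) = (psi : 'Hom(hom M Z, k^o)) (z \oc f).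
    have [x xE] := tau_ex Z (psi \o prem Z f)%VF.
    by exists x => z; rewrite xE comp_lfunE premE.
  have tau_injE Z (x y : hom Z I) :
      (forall z, tau (x \oc z) = tau (y \oc z)) -> x = y.
    move=> xy; apply/eqP; rewrite -subr_eq0; apply/eqP/tau_inj => z.
    by rewrite compBl linearB /= xy subrr.
  have [j jE] := ex_fun (fun Z => ex_fun (ex_j Z)).
  have jL Z : linear (j Z).
    move=> a x y; apply: tau_injE => z; rewrite jE compDl compZl linearP /= !jE.
    exact: dualv_lincombE.
  have [|g [gJ _]] := univJ I (fun Z => linfun (j Z)).
    move=> Z Z' h psi; rewrite !(linfun_linE (jL _)); apply: tau_injE => z.
    by rewrite -compA !jE dualE comp_lfunE postmE compA.
  have := gJ G phi; rewrite Jphi0 comp0r linfun_linE // => jphi0.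
  by rewrite -[f]comp1m -jE -jphi0 comp0l linear0.
(* A functional vanishing on the image of [J G] is given by some [x] from [W] to [I] that kills
   every [J Z phi]; uniqueness in the universal property forces [x] to be zero. *)
- apply: functional_separation => th th0; have [x xE] := tau_ex W th.
  have xJ0 Z phi : x \oc J Z phi = 0.
    by apply: tau_inj => z; rewrite -compA dinatJ xE th0.
  have [|g [_ g_uniq]] := univJ I (fun Z => 0).
    by move=> Z Z' h phi; rewrite !zero_lfunE comp0l.
  have x0 : x = 0.
    rewrite -(g_uniq 0) => [|Z phi]; last by rewrite comp0l zero_lfunE.
    by apply/esym/g_uniq => Z phi; rewrite xJ0 zero_lfunE.
  by apply/lfunP => z; rewrite -xE x0 comp0l linear0 zero_lfunE.
Qed.

(** [P] is a summand of a power of [G], and dinaturality along the maps [s_] and [r_] carries the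
    bijection from [G] to [P]. *)
Lemma coend_projective_bij (P : C) : projective P ->
  (forall phi, J P phi = 0 -> phi = 0) /\ (forall h, exists phi, J P phi = h).
Proof.
move=> projP; have [G [I [tau [sepG _ dualI]]]] :=
  finite_abelian_generator finC.
have [J_inj J_surj] := coend_generator_bij dualI.
have [n [s_ [r_ rs]]] := projective_summand finC sepG projP.
have [dinatJ _] := coendJ; split.
- move=> phi Jphi0; apply/lfunP => f; rewrite [RHS]zero_lfunE.
  rewrite -[f]comp1m -rs comp_suml linear_sum big1 // => i _ /=.
  have /J_inj/lfunP/(_ (s_ i \oc f)) : J G (dualvm (postm M (r_ i)) phi) = 0.
    by rewrite -dinatJ Jphi0 comp0l.
  by rewrite dualE comp_lfunE postmE compA => ->; rewrite zero_lfunE.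
- move=> h; have [phi_ phiE] := ex_fun (fun i => J_surj (h \oc r_ i)).
  exists (\sum_i dualvm (postm M (s_ i)) (phi_ i)).
  rewrite linear_sum -[RHS]compm1 -rs comp_sumr; apply: eq_bigr => i _ /=.
  by rewrite -dinatJ phiE compA.
Qed.

End CoendProjective.

(** * Coherence for strict monoidal structures *)

Section Casts.
Variables (k : fieldType) (C : linCat k).
Implicit Types X Y Z : C.

Lemma castm_irr X Y (e e' : X = Y) : castm e = castm e'.
Proof. by rewrite (proof_irrelevance _ e e'). Qed.

Lemma castm_id X (e : X = X) : castm e = idm X.
Proof. exact: (castm_irr e erefl). Qed.

Lemma castm_comp X Y Z (e : X = Y) (e' : Y = Z) :
  castm e' \oc castm e = castm (etrans e e').
Proof. by case: _ / e'; rewrite comp1m. Qed.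

Lemma castmK X Y (e : X = Y) (e' : Y = X) : castm e' \oc castm e = idm X.
Proof. by rewrite castm_comp castm_id. Qed.

(** Parallel casts are equal by proof irrelevance ([is_cast_eq]), which plays the role of a
    coherence theorem. *)
Definition is_cast X Y (c : hom X Y) := exists e : X = Y, c = castm e.

Lemma is_castm X Y (e : X = Y) : is_cast (castm e).
Proof. by exists e. Qed.

Lemma is_cast_id X : is_cast (idm X).
Proof. by exists erefl. Qed.

Lemma is_cast_comp X Y Z (g : hom Y Z) (f : hom X Y) :
  is_cast g -> is_cast f -> is_cast (g \oc f).
Proof. by case=> e -> [e' ->]; rewrite castm_comp; exists (etrans e' e). Qed.

Lemma is_cast_eq X Y (f g : hom X Y) : is_cast f -> is_cast g -> f = g.
Proof. by case=> e -> [e' ->]; apply: castm_irr. Qed.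

Definition heq X Y X' Y' (f : hom X Y) (g : hom X' Y') :=
  exists (eX : X = X') (eY : Y = Y'), castm eY \oc f = g \oc castm eX.

Lemma heq_refl X Y (f : hom X Y) : heq f f.
Proof. by exists erefl, erefl; rewrite comp1m compm1. Qed.

Lemma heqE X Y (f g : hom X Y) : heq f g -> f = g.
Proof. by case=> eX [eY]; rewrite !castm_id comp1m compm1. Qed.

Lemma heq_sym X Y X' Y' (f : hom X Y) (g : hom X' Y') : heq f g -> heq g f.
Proof.
case=> eX; case: _ / eX g => g [eY]; case: _ / eY g => g.
by rewrite comp1m compm1 => ->; apply: heq_refl.
Qed.

Lemma heq_trans X Y X' Y' X'' Y'' (f : hom X Y) (g : hom X' Y') (h : hom X''
  Y'') :
  heq f g -> heq g h -> heq f h.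
Proof.
case=> eX; case: _ / eX g => g [eY]; case: _ / eY g => g.
by rewrite comp1m compm1 => ->.
Qed.

Lemma heq_comp X Y Z X' Y' Z' (g : hom Y Z) (f : hom X Y)
    (g' : hom Y' Z') (f' : hom X' Y') :
  heq g g' -> heq f f' -> heq (g \oc f) (g' \oc f').
Proof.
case=> eY; case: _ / eY g' f' => g' f' [eZ]; case: _ / eZ g' => g'.
rewrite comp1m compm1 => -> [eX]; case: _ / eX f' => f' [eY].
by rewrite (castm_id eY) comp1m compm1 => ->; apply: heq_refl.
Qed.

Lemma heq_cast X Y X' Y' (c : hom X Y) (c' : hom X' Y') :
  X = X' -> is_cast c -> is_cast c' -> heq c c'.
Proof.
move=> eX; case: _ / eX c' => c' [eY ->]; case: _ / eY => -[eY ->].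
case: _ / eY; exact: heq_refl.
Qed.

Lemma heq_castl X Y Z (c : hom Y Z) (f : hom X Y) : is_cast c ->
  heq (c \oc f) f.
Proof. by case=> e ->; case: _ / e; rewrite comp1m; apply: heq_refl. Qed.

Lemma heq_castr X Y Z (c : hom X Y) (f : hom Y Z) : is_cast c ->
  heq (f \oc c) f.
Proof. by case=> e ->; case: _ / e f => f; rewrite compm1; apply: heq_refl. Qed.

End Casts.

(** * Monoidal calculus and the adjunctions given by dual pairs *)

Section MonCat.
Variables (k : fieldType) (C : monCat k).
Implicit Types X Y Z M N D : C.

Lemma tensm_compl X Y Z M (g : hom Y Z) (f : hom X Y) :
  (g \oc f) \om idm M = (g \om idm M) \oc (f \om idm M).
Proof. by rewrite -tensmM comp1m. Qed.

Lemma tensm_compr X Y Z M (g : hom Y Z) (f : hom X Y) :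
  idm M \om (g \oc f) = (idm M \om g) \oc (idm M \om f).
Proof. by rewrite -tensmM comp1m. Qed.

Lemma tensm_split X Y X' Y' (f : hom X Y) (g : hom X' Y') :
  (f \om idm Y') \oc (idm X \om g) = f \om g.
Proof. by rewrite -tensmM compm1 comp1m. Qed.

Lemma tensm_swap X Y X' Y' (f : hom X Y) (g : hom X' Y') :
  (idm Y \om g) \oc (f \om idm X') = (f \om idm Y') \oc (idm X \om g).
Proof. by rewrite -!tensmM !compm1 !comp1m. Qed.

Lemma is_cast_tens X Y X' Y' (f : hom X Y) (g : hom X' Y') :
  is_cast f -> is_cast g -> is_cast (f \om g).
Proof.
case=> e ->; case: _ / e => -[e ->]; case: _ / e.
by exists erefl; rewrite tensm1.
Qed.

Lemma is_cast_asso X Y Z : is_cast (asso X Y Z). Proof. by exists (tensA X Y Z).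
  Qed.
Lemma is_cast_assoV X Y Z : is_cast (assoV X Y Z).
Proof. by exists (esym (tensA X Y Z)). Qed.
Lemma is_cast_lu X : is_cast (lu X). Proof. by exists (tens1X X). Qed.
Lemma is_cast_luV X : is_cast (luV X). Proof. by exists (esym (tens1X X)). Qed.
Lemma is_cast_ru X : is_cast (ru X). Proof. by exists (tensX1 X). Qed.
Lemma is_cast_ruV X : is_cast (ruV X). Proof. by exists (esym (tensX1 X)). Qed.

Lemma heq_tens X Y X' Y' U V U' V' (f : hom X Y) (g : hom X' Y')
    (f' : hom U V) (g' : hom U' V') :
  heq f g -> heq f' g' -> heq (f \om f') (g \om g').
Proof.
case=> eX; case: _ / eX g => g [eY]; case: _ / eY g => g.
rewrite comp1m compm1 => -> [eU]; case: _ / eU g' => g' [eV].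
case: _ / eV g' => g'; rewrite comp1m compm1 => ->; exact: heq_refl.
Qed.

Lemma heq_tensA X Y X' Y' X'' Y'' (f : hom X Y) (g : hom X' Y') (h : hom X''
  Y'') :
  heq (f \om g \om h) (f \om (g \om h)).
Proof. by exists (tensA _ _ _), (tensA _ _ _); rewrite tensmA. Qed.

Lemma heq_tens1l X Y (f : hom X Y) : heq (idm one \om f) f.
Proof. by exists (tens1X _), (tens1X _); rewrite tensm1f. Qed.

Lemma asso_nat X Y Z X' Y' Z' (f : hom X X') (g : hom Y Y') (h : hom Z Z') :
  asso X' Y' Z' \oc (f \om g \om h) = (f \om (g \om h)) \oc asso X Y Z.
Proof. exact: tensmA. Qed.

Lemma assoK X Y Z : assoV X Y Z \oc asso X Y Z = idm _.
Proof. exact: castmK. Qed.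
Lemma assoVK X Y Z : asso X Y Z \oc assoV X Y Z = idm _.
Proof. exact: castmK. Qed.
Lemma luK X : luV X \oc lu X = idm _. Proof. exact: castmK. Qed.
Lemma luVK X : lu X \oc luV X = idm _. Proof. exact: castmK. Qed.
Lemma ruK X : ruV X \oc ru X = idm _. Proof. exact: castmK. Qed.
Lemma ruVK X : ru X \oc ruV X = idm _. Proof. exact: castmK. Qed.

Lemma assoV_nat X Y Z X' Y' Z' (f : hom X X') (g : hom Y Y') (h : hom Z Z') :
  assoV X' Y' Z' \oc (f \om (g \om h)) = (f \om g \om h) \oc assoV X Y Z.
Proof.
rewrite -[LHS]compm1 -(assoVK X Y Z) !compA; congr (_ \oc _).
by rewrite -[_ \oc asso _ _ _]compA -asso_nat compA assoK comp1m.
Qed.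

Lemma lu_nat X Y (f : hom X Y) : lu Y \oc (idm one \om f) = f \oc lu X.
Proof. exact: tensm1f. Qed.
Lemma ru_nat X Y (f : hom X Y) : ru Y \oc (f \om idm one) = f \oc ru X.
Proof. exact: tensmf1. Qed.
Lemma luV_nat X Y (f : hom X Y) : luV Y \oc f = (idm one \om f) \oc luV X.
Proof.
rewrite -[f in LHS]compm1 -(luVK X) [f \oc _]compA -lu_nat !compA.
by rewrite luK comp1m.
Qed.
Lemma ruV_nat X Y (f : hom X Y) : ruV Y \oc f = (f \om idm one) \oc ruV X.
Proof.
rewrite -[f in LHS]compm1 -(ruVK X) [f \oc _]compA -ru_nat !compA.
by rewrite ruK comp1m.
Qed.

(* [unitr] and [counitr] turn a pairing of objects into natural transformations
   between endofunctors of the form [- \ox X]; working with them instead of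
   [c] and [e] removes all associativity constraints from the calculations. *)
Definition unitr X D (c : hom one (X \ox D)) M : hom M (M \ox X \ox D) :=
  locked (assoV M X D \oc (idm M \om c) \oc ruV M).

Definition counitr X D (e : hom (D \ox X) one) M : hom (M \ox D \ox X) M :=
  locked (ru M \oc (idm M \om e) \oc asso M D X).

Lemma unitr_nat X D (c : hom one (X \ox D)) M N (f : hom M N) :
  unitr c N \oc f = (f \om idm X \om idm D) \oc unitr c M.
Proof.
rewrite /unitr -!lock -compA ruV_nat !compA; congr (_ \oc _).
by rewrite -assoV_nat -!compA; congr (_ \oc _); rewrite tensm_swap tensm1.
Qed.

Lemma counitr_nat X D (e : hom (D \ox X) one) M N (f : hom M N) :
  counitr e N \oc (f \om idm D \om idm X) = f \oc counitr e M.
Proof.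
rewrite /counitr -!lock -[LHS]compA asso_nat !compA; congr (_ \oc _).
by rewrite -ru_nat -!compA; congr (_ \oc _); rewrite tensm1 tensm_swap.
Qed.

Lemma unitr_one X D (c : hom one (X \ox D)) :
  (lu X \om idm D) \oc unitr c one = c.
Proof.
rewrite /unitr -lock; apply: heqE; apply: heq_trans (heq_castl _ _) _.
  by apply: is_cast_tens; [apply: is_cast_lu | apply: is_cast_id].
apply: heq_trans (heq_castr _ (is_cast_ruV _)) _.
by apply: heq_trans (heq_castl _ (is_cast_assoV _ _ _)) _; apply: heq_tens1l.
Qed.

Lemma counitr_one X D (e : hom (D \ox X) one) :
  counitr e one = e \oc (lu D \om idm X).
Proof.
rewrite /counitr -lock; apply: heqE; apply: heq_sym;
  apply: heq_trans (heq_castr _ _) _.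
  by apply: is_cast_tens; [apply: is_cast_lu | apply: is_cast_id].
apply: heq_sym; apply: heq_trans (heq_castr _ (is_cast_asso _ _ _)) _.
by apply: heq_trans (heq_castl _ (is_cast_ru _)) _; apply: heq_tens1l.
Qed.

Section Zigzag.
Variables (X D : C) (c : hom one (X \ox D)) (e : hom (D \ox X) one).
Hypothesis zig1 :
  ru X \oc (idm X \om e) \oc asso X D X \oc (c \om idm X) \oc luV X = idm X.
Hypothesis zig2 :
  lu D \oc (e \om idm D) \oc assoV D X D \oc (idm D \om c) \oc ruV D = idm D.

Lemma counitr_coev : counitr e X \oc (c \om idm X) = lu X.
Proof. by rewrite /counitr -lock -[LHS]compm1 -(luK X) compA zig1 comp1m. Qed.

Lemma unitr_ev : (e \om idm D) \oc unitr c D = luV D.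
Proof.
by rewrite /unitr -lock -[LHS]comp1m -(luK D) -[RHS]compm1 -[in RHS]zig2 !compA.
Qed.

(** A triangle identity for [- \ox X] as left adjoint of [- \ox D], obtained by tensoring [zig1]
    with [M]; the two sides agree factor by factor up to casts. *)
Lemma counitr_unitr M : counitr e (M \ox X) \oc (unitr c M \om idm X) = idm _.
Proof.
rewrite -tensm1 -[in RHS]zig1; apply: heqE; rewrite /counitr /unitr -!lock.
rewrite !tensm_compl !tensm_compr !compA.
apply: heq_comp; last first.
  apply: heq_cast => //.
    by apply: is_cast_tens; [apply: is_cast_ruV | apply: is_cast_id].
  by apply: is_cast_tens; [apply: is_cast_id | apply: is_cast_luV].
apply: heq_comp; last exact: heq_tensA.
rewrite -[ru (M \ox X) \oc _ \oc _ \oc _]compA; apply: heq_comp; last first.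
  apply: heq_cast; first by rewrite !tensA.
    by apply: is_cast_comp; [apply: is_cast_asso | apply: is_cast_tens;
      [apply: is_cast_assoV | apply: is_cast_id]].
  by apply: is_cast_tens; [apply: is_cast_id | apply: is_cast_asso].
apply: heq_comp.
  apply: heq_cast; rewrite ?tensA ?tensX1 //; first exact: is_cast_ru.
  by apply: is_cast_tens; [apply: is_cast_id | apply: is_cast_ru].
by rewrite -tensm1; apply: heq_tensA.
Qed.

Lemma unitr_counitr M : (counitr e M \om idm D) \oc unitr c (M \ox D) = idm _.
Proof.
rewrite -tensm1 -[in RHS]zig2; apply: heqE; rewrite /counitr /unitr -!lock.
rewrite !tensm_compl !tensm_compr !compA.
apply: heq_comp; last first.
  apply: heq_cast; rewrite ?tensA ?tensX1 //; first exact: is_cast_ruV.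
  by apply: is_cast_tens; [apply: is_cast_id | apply: is_cast_ruV].
apply: heq_comp; last by rewrite -tensm1; apply: heq_tensA.
rewrite -[_ \oc (asso M D X \om _) \oc _]compA; apply: heq_comp; last first.
  apply: heq_cast; first by rewrite !tensA.
    by apply: is_cast_comp; [apply: is_cast_tens; [apply: is_cast_asso |
      apply: is_cast_id] | apply: is_cast_assoV].
  by apply: is_cast_tens; [apply: is_cast_id | apply: is_cast_assoV].
apply: heq_comp; last exact: heq_tensA.
apply: heq_cast; rewrite ?tensA ?tensX1 ?tens1X //.
  by apply: is_cast_tens; [apply: is_cast_ru | apply: is_cast_id].
by apply: is_cast_tens; [apply: is_cast_id | apply: is_cast_lu].
Qed.

Lemma transposeK M N (f : hom M (N \ox D)) :
  ((counitr e N \oc (f \om idm X)) \om idm D) \oc unitr c M = f.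
Proof.
by rewrite tensm_compl -compA -unitr_nat compA unitr_counitr comp1m.
Qed.

Lemma untransposeK M N (f : hom (M \ox X) N) :
  counitr e N \oc (((f \om idm D) \oc unitr c M) \om idm X) = f.
Proof.
by rewrite tensm_compl compA counitr_nat -compA counitr_unitr compm1.
Qed.

Lemma transpose_inj M N (f g : hom M (N \ox D)) :
  counitr e N \oc (f \om idm X) = counitr e N \oc (g \om idm X) -> f = g.
Proof. by move=> fg; rewrite -[f]transposeK fg transposeK. Qed.

Lemma untranspose_inj M N (f g : hom (M \ox X) N) :
  (f \om idm D) \oc unitr c M = (g \om idm D) \oc unitr c M -> f = g.
Proof. by move=> fg; rewrite -[f]untransposeK fg untransposeK. Qed.

Lemma epi_tensr_ladj M N (f : hom M N) : epi f -> epi (f \om idm X).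
Proof.
move=> epi_f Z g h ghf; apply: untranspose_inj; apply: epi_f.
by rewrite -!compA !unitr_nat !compA -!tensm_compl ghf.
Qed.

End Zigzag.
End MonCat.

(** * The reversed tensor product *)

Section Reverse.
Variables (k : fieldType) (C : monCat k).

(** The underlying linear category is literally that of [C], so projectivity, coends and traces pass
    to [revCat] by conversion. *)
Definition revCat : monCat k.
Proof.
refine (@MonCat k C one (fun X Y => Y \ox X) (fun X Y X' Y' f g => g \om f)
  _ _ _ _ (fun X Y Z => esym (tensA Z Y X)) (fun X => tensX1 X)
  (fun X => tens1X X) _ _ _).
- by move=> X Y X' Y' g a f f'; rewrite tensm_linr.
- by move=> X Y X' Y' f a g g'; rewrite tensm_linl.
- by move=> X Y; rewrite tensm1.
- by move=> X Y Z X' Y' Z' g f g' f'; rewrite tensmM.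
- by move=> X Y Z X' Y' Z' f g h; apply: assoV_nat.
- by move=> X Y f; apply: ru_nat.
- by move=> X Y f; apply: lu_nat.
Defined.

Lemma asso_rev (X Y Z : C) : @asso k revCat X Y Z = assoV Z Y X.
Proof. exact: castm_irr. Qed.

Lemma assoV_rev (X Y Z : C) : @assoV k revCat X Y Z = asso Z Y X.
Proof. exact: castm_irr. Qed.

Lemma right_duality_rev (d : C -> C) (e : forall X, hom (X \ox d X) one) c :
  right_duality e c -> left_duality (C := revCat) e c.
Proof.
move=> dualC X; have [zig1 zig2] := dualC X.
by split; [exact: zig1 | rewrite assoV_rev].
Qed.

End Reverse.

(** * Closing operators and projective objects in rigid categories *)

Section Closing.
Variables (k : fieldType) (C : monCat k).
Implicit Types X Y Z M N D P : C.

(** Common form of both closing operators: [clr] in [C] and [cll] in [revCat]. *)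
Definition close X Y D (c : hom one (X \ox D)) (e : hom (Y \ox D) one) M N
    (f : hom (M \ox X) (N \ox Y)) : hom M N :=
  counitr e N \oc (f \om idm D) \oc unitr c M.

Lemma close_nat X Y D (c : hom one (X \ox D)) (e : hom (Y \ox D) one) M M' N N'
    (b : hom N N') (f : hom (M \ox X) (N \ox Y)) (a : hom M' M) :
  close c e ((b \om idm Y) \oc f \oc (a \om idm X)) = b \oc close c e f \oc a.
Proof.
rewrite /close !tensm_compl !compA counitr_nat.
by rewrite -[LHS]compA -unitr_nat !compA.
Qed.

End Closing.

Section LeftDuals.
Variables (k : fieldType) (C : monCat k) (d : C -> C).
Variables (e : forall X, hom (d X \ox X) one) (c : forall X,
  hom one (X \ox d X)).
Hypothesis dualC : left_duality e c.
Implicit Types X Y Z M N P : C.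

Let zig1 X := (dualC X).1.

Lemma epi_tensr M N X (f : hom M N) : epi f -> epi (f \om idm X).
Proof. exact: (epi_tensr_ladj (zig1 X)). Qed.

(** The right adjoint [- \ox d X] of [- \ox X] preserves epis, being itself left adjoint to
    [- \ox d (d X)]. *)
Lemma projective_tensr P X : projective P -> projective (P \ox X).
Proof.
move=> projP Y Y' g f epi_g.
have [h hE] := projP _ _ _ ((f \om idm (d X)) \oc unitr (c X) P)
  (epi_tensr (X := d X) epi_g).
exists (counitr (e X) Y \oc (h \om idm X)).
rewrite compA -counitr_nat -compA -tensm_compl hE.
exact: (untransposeK (zig1 X)).
Qed.

End LeftDuals.

Section RigidClosing.
Variables (k : fieldType) (C : rigidCat k).
Implicit Types X M N P : C.

Lemma clrE M N X (f : hom (M \ox X) (N \ox X^l^l)) :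
  clr f = close (coev X) (ev X^l) f.
Proof. by rewrite /close /counitr /unitr -!lock !compA. Qed.

Lemma cllE X M N (f : hom (X \ox M) (X^r^r \ox N)) :
  cll f = close (C := revCat C) (coevr X) (evr X^r) f.
Proof.
by rewrite /close /counitr /unitr -!lock asso_rev assoV_rev !compA.
Qed.

Lemma rigid_projective_tensr P X : projective P -> projective (P \ox X).
Proof. exact: (projective_tensr (ldualP (r := C))). Qed.

Lemma rigid_projective_tensl P X : projective P -> projective (X \ox P).
Proof. exact: (projective_tensr (right_duality_rev (rdualP (r := C)))). Qed.

(** The zigzag identity makes [X] a retract of [X \ox X^l \ox X]. *)
Lemma projective_of_ldual X : projective X^l -> projective X.
Proof.
move=> projX; apply: (@projective_retract _ _ _ (X \ox X^l \ox X)
  ((coev X \om idm X) \oc luV X) (counitr (ev X) X)).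
  by rewrite compA (counitr_coev (ldualP X).1) luVK.
by apply/rigid_projective_tensr/rigid_projective_tensl.
Qed.

End RigidClosing.

Definition represents (k : fieldType) (C : linCat k)
    (t : forall P : C, projective P -> 'Hom(hom P P, k^o))
    (M Z : C) (phi : dualv (hom M Z)) (y : hom Z M) : Prop :=
  forall (P : C) (hP : projective P) (z : hom P Z) (f : hom M P),
    t P hP (f \oc y \oc z) = (phi : 'Hom(hom M Z, k^o)) (z \oc f).

(** * Nondegeneracy of a nonzero modified trace *)

Section Nondegeneracy.
Variables (k : fieldType) (C : rigidCat k) (p : pivotal C).
Hypothesis finC : finite_abelian C.
Hypothesis simple1 : simple_object (one : C).
Variable t : forall P : C, projective P -> 'Hom(hom P P, k^o).
Hypothesis trt : modified_trace p t.
Implicit Types X Y Z M N P Q R : C.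

(** The kernel of [b] is a subobject of the simple unit: it is zero, or else it is everything and
    [b] vanishes. *)
Lemma mono_from_one Z (b : hom one Z) : b <> 0 -> mono b.
Proof.
move=> b_neq0; have [K [i [bi0 mono_i kerP]]] := finite_abelian_kernel finC b.
have [zK|[j [_ ij]]] := simple1.2 K i mono_i; last first.
  by case: b_neq0; rewrite -[b]compm1 -ij compA bi0 comp0l.
apply: mono_eq0 => Y g /kerP[h <-].
by rewrite -[h]comp1m zK comp0l comp0r.
Qed.

Lemma epi_to_one R (a : hom R one) : a <> 0 -> epi a.
Proof.
move=> a_neq0; apply: epi_eq0 => Z g ga0; apply: NNPP => g_neq0.
by apply: a_neq0; apply: (mono_from_one g_neq0); rewrite ga0 comp0r.
Qed.

(* The pivotal structure turns [X^l] into a dual of [X] on the other side. *)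
Definition pcounit X : hom (X \ox X^l) one := ev X^l \oc (piv p X \om idm X^l).

(** Transposition of [b] along the pivotal duality, which moves [X] to the source as [X^l]. *)
Definition bend M X (b : hom one (M \ox X)) : hom X^l M :=
  counitr (pcounit X) M \oc (b \om idm X^l) \oc luV X^l.

Lemma counitr_pcounit M X :
  counitr (pcounit X) M = counitr (ev X^l) M \oc (idm M \om piv p X \om idm
    X^l).
Proof.
by rewrite /counitr -!lock /pcounit tensm_compr -[RHS]compA asso_nat !compA.
Qed.

Lemma bendE M X (b : hom one (M \ox X)) :
  bend b = counitr (ev X^l) M \oc (((idm M \om piv p X) \oc b) \om idm X^l) \oc
    luV X^l.
Proof. by rewrite /bend counitr_pcounit tensm_compl compA. Qed.

Lemma bend_nat M N X (f : hom M N) (b : hom one (M \ox X)) :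
  bend ((f \om idm X) \oc b) = f \oc bend b.
Proof. by rewrite /bend tensm_compl !compA counitr_nat. Qed.

(** The right partial trace property for the given endomorphism followed by [piv p X]: closing up
    [X] bends [b], and a zigzag straightens [ev X] to leave [u]. *)
Lemma trace_bend P X (hP : projective P) (hPX : projective (P \ox X))
    (b : hom one (P \ox X)) (u : hom P X^l) :
  t hPX (b \oc (ev X \oc (u \om idm X))) = t hP (bend b \oc u).
Proof.
pose h := (idm P \om piv p X) \oc (b \oc (ev X \oc (u \om idm X))).
have := mtr_right trt hP hPX h.
rewrite {2}/h compA -tensmM comp1m (pivK p X).1 tensm1 comp1m => <-;
  congr (t hP _).
rewrite clrE /close /h /bend counitr_pcounit !tensm_compl -!compA;
  congr (_ \oc (_ \oc (_ \oc _))).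
by rewrite -unitr_nat compA (unitr_ev (ldualP X).2).
Qed.

(** Any endomorphism [g] of [X^l] is the bending of [(g \om pivV p X) \oc coev X^l], so its trace is
    that of a morphism factoring through the unit. *)
Lemma trace_one_neq0 P (hP : projective P) (g : hom P P) : t hP g <> 0 ->
  exists Q (hQ : projective Q) (a : hom Q one) (b : hom one Q),
    t hQ (b \oc a) <> 0.
Proof.
(* Every object is a left dual, here of [P^r], which puts the trace in the form handled by
   [trace_bend]. *)
move: hP g; rewrite -(rdualK P); set X := P^r => hP g tg_neq0.
have hPX : projective (X^l \ox X) by apply: rigid_projective_tensr.
pose b := (g \om pivV p X) \oc coev X^l.
exists _, hPX, (ev X \oc (idm _ \om idm X)), b; rewrite (trace_bend hP) compm1.
suff -> : bend b = g by [].
rewrite bendE /b compA -tensmM comp1m (pivK p X).2 tensm_compl compA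
  counitr_nat.
by rewrite -[g \oc _ \oc _]compA (counitr_coev (ldualP X^l).1) -compA luVK
  compm1.
Qed.

Hypothesis nz : exists P (hP : projective P) (f : hom P P), t hP f <> 0.

(** Some [b0 \oc a0] through the unit has nonzero trace. As [a] is epi, [a0] lifts to [s] along it,
    and cyclicity identifies the trace of [s \oc b0 \oc a] with that of [b0 \oc a0]. *)
Lemma trace_to_one R (hR : projective R) (a : hom R one) : a <> 0 ->
  exists b : hom one R, t hR (b \oc a) <> 0.
Proof.
move=> /epi_to_one epi_a; have [P [hP [f /trace_one_neq0]]] := nz.
case=> Q [hQ [a0 [b0 tba_neq0]]]; have [s as_a0] := hQ _ _ a a0 epi_a.
exists (s \oc b0); rewrite -compA (mtr_cyclic trt hR hQ).
by rewrite -compA as_a0.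
Qed.

Lemma trace_nondegl P (hP : projective P) M (u : hom P M) :
  (forall f : hom M P, t hP (f \oc u) = 0) -> u = 0.
Proof.
move: u; rewrite -(rdualK M); set X := M^r => u tu0; apply: NNPP => u_neq0.
have hPX : projective (P \ox X) by apply: rigid_projective_tensr.
have [|b] := trace_to_one hPX (a := ev X \oc (u \om idm X)).
  (* A zigzag recovers [u] from [ev X \oc (u \om idm X)], so the latter is nonzero. *)
  move=> a0; apply: u_neq0; rewrite -[u]comp1m -(luVK X^l) -compA.
  rewrite -(unitr_ev (ldualP X).2) -[_ \oc _ \oc u]compA unitr_nat.
  by rewrite !compA -[lu _ \oc _ \oc _]compA -tensm_compl a0 -tensmrE linear0
    comp0r comp0l.
by rewrite (trace_bend hP) tu0.
Qed.

(** With [P] written as [X^l], the object [X] is projective, hence so is [M \ox X]. A nonzero trace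
    found there moves by cyclicity to [X^l \ox X], where it can be bent. *)
Lemma trace_nondegr P (hP : projective P) M (f : hom M P) :
  (forall u : hom P M, t hP (f \oc u) = 0) -> f = 0.
Proof.
move: hP f; rewrite -(rdualK P); set X := P^r => hP f tf0;
  apply: NNPP => f_neq0.
have hX : projective X by apply: projective_of_ldual.
have hMX : projective (M \ox X) by apply: rigid_projective_tensl.
have hXX : projective (X^l \ox X) by apply: rigid_projective_tensl.
have [|b] := trace_to_one hMX (a := ev X \oc (f \om idm X)).
  move=> a0; apply: f_neq0; rewrite -[f]comp1m -(luVK X^l) -compA.
  rewrite -(unitr_ev (ldualP X).2) -[_ \oc _ \oc f]compA unitr_nat.
  by rewrite !compA -[lu _ \oc _ \oc _]compA -tensm_compl a0 -tensmrE linear0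
    comp0r comp0l.
rewrite compA (mtr_cyclic trt hMX hXX) compA.
have := trace_bend hP hXX ((f \om idm X) \oc b) (idm _).
by rewrite tensm1 compm1 => ->; rewrite compm1 bend_nat tf0.
Qed.

Lemma represents_uniq M Z (phi : dualv (hom M Z)) y y' :
  represents t phi y -> represents t phi y' -> y = y'.
Proof.
have [G [I [tau [sepG _ /dualizing_projective hG]]]] :=
  finite_abelian_generator finC.
move=> y_phi y'_phi; apply: (separating_eq sepG) => z.
apply/eqP; rewrite -subr_eq0; apply/eqP; apply: (trace_nondegl (hP := hG)) => f.
by rewrite compBr linearB /= !compA y_phi y'_phi subrr.
Qed.

Lemma trace_pairing_surj P (hP : projective P) M (phi : dualv (hom M P)) :
  exists u : hom P M, forall f : hom M P, t hP (f \oc u) =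
    (phi : 'Hom(hom M P, k^o)) f.
Proof.
pose B : 'Hom(hom P M, dualv (hom M P)) :=
  linfun (fun u => linfun (fun f => t hP (f \oc u))).
have lin1 u : linear (fun f : hom M P => t hP (f \oc u)).
  by move=> a x y; rewrite compDl compZl linearP.
have BE u f : (B u : 'Hom(hom M P, k^o)) f = t hP (f \oc u).
  rewrite /B linfun_linE ?(linfun_linE (lin1 _)) // => a x y; apply/lfunP => g.
  apply: etrans _ (esym (dualv_lincombE a _ _ g)).
  by rewrite !(linfun_linE (lin1 _)) comp_linr linearP.
have [u Bu|f Bf|u <-] := perfect_pairing (B := B) _ _ phi.
- by apply: trace_nondegl => f; rewrite -BE Bu zero_lfunE.
- by apply: trace_nondegr => u; rewrite -BE.
- by exists u => f; rewrite BE.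
Qed.

(** Over [G], perfectness of the pairing defines [z |-> y \oc z] as a linear map [T]. Cyclicity
    makes [T] commute with endomorphisms of [G], so density yields [y]; a general projective is a
    summand of a power of [G]. *)
Lemma represents_ex M Z (phi : dualv (hom M Z)) : exists y, represents t phi y.
Proof.
have [G [I [tau [sepG denseG dualG]]]] := finite_abelian_generator finC.
have hG := dualizing_projective dualG.
have ex_T (z : hom G Z) : exists u : hom G M, forall f : hom M G,
    t hG (f \oc u) = (phi : 'Hom(hom M Z, k^o)) (z \oc f).
  have [u uE] := trace_pairing_surj hG (dualvm (postm M z) phi).
  by exists u => f; rewrite uE dualE comp_lfunE postmE.
have [T TE] := ex_fun ex_T.
have eqG (u u' : hom G M) : (forall f, t hG (f \oc u) = t hG (f \oc u')) ->
  u = u'.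
  move=> uu'; apply/eqP; rewrite -subr_eq0; apply/eqP.
  by apply: (trace_nondegl (hP := hG)) => f;
    rewrite compBr linearB /= uu' subrr.
have linT : linear T.
  move=> a x y; apply: eqG => f.
  by rewrite TE comp_linr comp_linl !linearP /= !TE.
have [|y yE] := denseG _ _ (linfun T).
  move=> z g; rewrite !(linfun_linE linT); apply: eqG => f.
  by rewrite TE [in RHS]compA (mtr_cyclic trt hG hG) compA TE !compA.
exists y => P hP z f.
have [n [s_ [r_ rs]]] := projective_summand finC sepG hP.
rewrite -[in LHS](compm1 z) -[in RHS](compm1 z) -rs !comp_sumr comp_suml
  !linear_sum.
apply: eq_bigr => i _ /=.
rewrite !compA (mtr_cyclic trt hP hG) -!compA.
have := TE (z \oc r_ i) (s_ i \oc f).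
by rewrite -(linfun_linE linT) yE -!compA => <-.
Qed.

End Nondegeneracy.

(** * Partial traces and representing morphisms *)

Section PartialTraceRepresents.
Variables (k : fieldType) (C : monCat k) (d : C -> C).
Variables (e : forall X, hom (d X \ox X) one) (c : forall X,
  hom one (X \ox d X)).
Hypothesis dualC : left_duality e c.
Variable qV : forall X : C, hom (d (d X)) X.
Variable t : forall P : C, projective P -> 'Hom(hom P P, k^o).
Hypothesis t_cyclic : forall (P Q : C) (hP : projective P) (hQ : projective Q)
  (f : hom P Q) (g : hom Q P), t hP (g \oc f) = t hQ (f \oc g).
Hypothesis t_right : forall (P X : C) (hP : projective P)
  (hPX : projective (P \ox X)) (f : hom (P \ox X) (P \ox d (d X))),
  t hP (close (c X) (e (d X)) f) = t hPX ((idm P \om qV X) \oc f).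
Hypothesis t_nondeg : forall (P : C) (hP : projective P) M (u : hom P M),
  (forall f : hom M P, t hP (f \oc u) = 0) -> u = 0.
Variable G : C.
Hypotheses (sepG : separating G) (projG : projective G).

(* It suffices to test on morphisms [z \om idm] with [z] starting from a
   projective object, on which the partial trace property applies directly. *)
Lemma represents_close M X Z (phi : dualv (hom M Z)) y
    (psi : dualv (hom (M \ox X) (Z \ox d (d X)))) y' :
  (forall f, (psi : 'Hom(_, k^o)) f =
    (phi : 'Hom(hom M Z, k^o)) (close (c X) (e (d X)) f)) ->
  represents t phi y -> represents t psi y' -> y' = y \om qV X.
Proof.
move=> psiE y_phi y'_psi.
have test Q (hQ : projective Q) (z : hom Q Z) :
    y' \oc (z \om idm (d (d X))) = (y \om qV X) \oc (z \om idm (d (d X))).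
  have hQX : projective (Q \ox X) by apply: projective_tensr dualC _ _ _.
  have hQdX : projective (Q \ox d (d X)) by apply: projective_tensr dualC _ _ _.
  apply/eqP; rewrite -subr_eq0; apply/eqP; apply: (t_nondeg (hP := hQdX)) => f.
  rewrite compBr linearB /= !compA y'_psi psiE.
  have -> : (z \om idm _) \oc f = (z \om idm _) \oc f \oc (idm M \om idm X).
    by rewrite tensm1 compm1.
  rewrite close_nat compm1 -(y_phi _ hQ) -compA.
  (* Moving [y \oc z] inside the closure gives a closed endomorphism of [Q], to which the partial
     trace property applies. *)
  have -> : close (c X) (e (d X)) f \oc (y \oc z) =
      close (c X) (e (d X)) (f \oc ((y \oc z) \om idm X)).
    have := close_nat (c X) (e (d X)) (idm Q) f (y \oc z).
    by rewrite tensm1 !comp1m.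
  rewrite (t_right hQ hQX) (t_cyclic hQX hQdX) -[f \oc _ \oc _ in X in _ -
    X]compA.
  have -> : (y \om qV X) \oc (z \om idm _) =
    ((y \oc z) \om idm X) \oc (idm Q \om qV X).
    by rewrite -!tensmM !compm1 comp1m.
  by rewrite !compA subrr.
(* By adjunction, [z] is a unit followed by [z' \om idm], where [z'] starts at the projective object
   [G \ox d X]. *)
apply: (separating_eq sepG) => z.
have <- := transposeK (dualC (d X)).2 z.
rewrite !compA test //; exact: projective_tensr dualC _ _ projG.
Qed.

End PartialTraceRepresents.

Lemma copower_ex (k : fieldType) (C : linCat k) : finite_abelian C ->
  exists pw : forall (V : vectType k) (M : C), copower V M, True.
Proof.
move=> finC.
have ex_c (VM : vectType k * C) : exists c : copower VM.1 VM.2, True.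
  have [S [i_ [p_ powS]]] := finite_abelian_power finC
    (\dim (fullv : {vspace VM.1})) VM.2.
  exact: power_copower powS.
by have [pw _] := ex_fun ex_c; exists (fun V M => pw (V, M)).
Qed.

(** * The coend structure given by a trace *)

Section TraceToSpherical.
Variables (k : fieldType) (C : rigidCat k) (p : pivotal C).
Hypothesis finC : finite_abelian C.
Hypothesis simple1 : simple_object (one : C).

(** At [G] the map [J] has the section [beta], [u] going to the functional [t (- \oc u)]. A
    dinatural [J'] then gives a map [u |-> J' G (beta u)] that commutes with endomorphisms of [G];
    density turns it into the factorization [g], and [J_beta] gives uniqueness. *)
Lemma trace_coend (t : forall P : C, projective P -> 'Hom(hom P P, k^o)) :
  modified_trace p t ->
  (exists P (hP : projective P) (f : hom P P), t P hP f <> 0) ->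
  exists J : forall Z M : C, 'Hom(dualv (hom M Z), hom Z M),
    (forall Z M phi, represents t phi (J Z M phi)) /\
    forall M, coend (fun Z => J Z M).
Proof.
move=> trt nz.
have [J JE] := ex_fun (fun Z => ex_fun (fun M =>
  ex_fun (fun phi : dualv (hom M Z) => represents_ex finC simple1 trt nz phi))).
have uniq := represents_uniq finC simple1 trt nz.
have linJ Z M : linear (J Z M).
  move=> a phi psi; apply: (uniq _ _ _ _ _ (JE _ _ _)) => P hP z f.
  rewrite comp_linr comp_linl linearP /= !JE; exact/esym/dualv_lincombE.
exists (fun Z M => linfun (J Z M)); split=> [Z M phi | M].
  by rewrite linfun_linE.
have [G [I [tau [sepG denseG dualG]]]] := finite_abelian_generator finC.
have hG := dualizing_projective dualG.
split=> [Z Z' h phi | W J' dinatJ'].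
  rewrite !(linfun_linE (linJ _ _));
    apply: (uniq _ _ _ _ _ _ (JE _ _ _)) => P hP z f.
  by rewrite compA -compA JE dualE comp_lfunE postmE compA.
pose beta (u : hom G M) : dualv (hom M G) := linfun (fun f => t G hG (f \oc u)).
have betaE u (f : hom M G) : (beta u : 'Hom(hom M G, k^o)) f = t G hG (f \oc u).
  by rewrite /beta linfun_linE // => a x y; rewrite compDl compZl linearP.
have beta_lin : linear beta.
  move=> a u v; apply/lfunP => f;
    apply: etrans _ (esym (dualv_lincombE a _ _ f)).
  by rewrite !betaE comp_linr linearP.
have J_beta u : J G M (beta u) = u.
  apply: (separating_eq sepG) => z.
  apply/eqP; rewrite -subr_eq0; apply/eqP.
  apply: (trace_nondegl finC simple1 trt nz (hP := hG)) => f.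
  rewrite compBr linearB /= compA JE betaE.
  by rewrite -compA (mtr_cyclic trt hG hG) -compA subrr.
have [|g gE] := denseG M W (linfun (fun u => J' G (beta u))).
  have lin : linear (fun u => J' G (beta u)).
    by move=> a u v; rewrite beta_lin linearP.
  move=> u h; rewrite !(linfun_linE lin) dinatJ'; congr (J' G _).
  apply/lfunP => f; rewrite betaE dualE comp_lfunE postmE betaE.
  by rewrite compA (mtr_cyclic trt hG hG) compA.
have gE' u : g \oc u = J' G (beta u).
  rewrite -gE linfun_linE // => a x y; rewrite beta_lin linearP //.
exists g; split=> [Z phi | g' g'J].
  rewrite (linfun_linE (linJ _ _)); apply: (separating_eq sepG) => z.
  rewrite -compA gE' dinatJ'; congr (J' G _); apply/lfunP => f.
  by rewrite betaE dualE comp_lfunE postmE compA JE.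
apply: (separating_eq sepG) => u.
by rewrite gE' -g'J (linfun_linE (linJ _ _)) J_beta.
Qed.

End TraceToSpherical.

(** * The Nakayama functor without copowers, and sphericality from a trace *)

Definition nak_iota (k : fieldType) (C : linCat k) (N : nakayama C) (Z M : C) :
  'Hom(dualv (hom M Z), hom Z (N M)) := cop_iso _ _ (nak_in N Z M).

Lemma nak_iota_coend (k : fieldType) (C : linCat k) (N : nakayama C) (M : C) :
  coend (fun Z => nak_iota N Z M).
Proof. exact/nak_coendP/nakP. Qed.

Section NakayamaStructure.
Variables (k : fieldType) (C : rigidCat k) (N : nakayama C).

Lemma nak_PsiP Psi : @nak_Psi k C N Psi <->
  forall M X Z phi, Psi M X \oc (nak_iota N Z M phi \om idm X^l^l) =
    nak_iota N (Z \ox X^l^l) (M \ox X) (dualvm (clrm M Z X) phi).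
Proof.
split=> PsiE M X Z => [phi|].
  have := congr1 (fun f => f \oc cop_in _ phi) (PsiE M X Z).
  rewrite -!compA copm_in compm1 cop_descE comp_lfunE tensmrE -tensm_compl.
  by rewrite -!cop_isoE.
apply: cop_eq => phi.
rewrite -!compA copm_in compm1 cop_descE comp_lfunE tensmrE -tensm_compl.
by rewrite -!cop_isoE; apply: PsiE.
Qed.

Lemma nak_PhiP Phi : @nak_Phi k C N Phi <->
  forall X M Z phi, Phi X M \oc (idm X^r^r \om nak_iota N Z M phi) =
    nak_iota N (X^r^r \ox Z) (X \ox M) (dualvm (cllm X M Z) phi).
Proof.
split=> PhiE X M Z => [phi|].
  have := congr1 (fun f => f \oc cop_in _ phi) (PhiE X M Z).
  rewrite -!compA copm_in compm1 cop_descE comp_lfunE tensmlE -tensm_compr.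
  by rewrite -!cop_isoE.
apply: cop_eq => phi.
rewrite -!compA copm_in compm1 cop_descE comp_lfunE tensmlE -tensm_compr.
by rewrite -!cop_isoE; apply: PhiE.
Qed.

End NakayamaStructure.

Section BirdualPivot.
Variables (k : fieldType) (C : rigidCat k) (p : pivotal C).

(** This serves as the pivotal structure of [revCat], whose left duals are the right duals of
    [C]. *)
Definition piv_birdualV (X : C) : hom X X^r^r :=
  pivV p X^r^r \oc castm (esym (birdualK X)).

Lemma piv_birdualK X : inverse (piv_birdualV X) (piv_birdual p X).
Proof.
have [pVK pKV] := pivK p X^r^r; split; rewrite /piv_birdual /piv_birdualV.
  by rewrite compA -[castm _ \oc _ \oc _]compA pKV compm1 castmK.
by rewrite compA -[pivV _ _ \oc _ \oc _]compA castmK compm1 pVK.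
Qed.

End BirdualPivot.

Lemma inverse_tens (k : fieldType) (C : monCat k) (X Y X' Y' : C)
    (f : hom X Y) (g : hom Y X) (f' : hom X' Y') (g' : hom Y' X') :
  inverse f g -> inverse f' g' -> inverse (f \om f') (g \om g').
Proof. by move=> [gf fg] [gf' fg']; split;
  rewrite -tensmM ?gf ?gf' ?fg ?fg' tensm1. Qed.

Lemma inverse_id (k : fieldType) (C : linCat k) (X : C) : inverse (idm X) (idm
  X).
Proof. by split; rewrite comp1m. Qed.

Lemma inverse_sym (k : fieldType) (C : linCat k) (X Y : C) (f : hom X Y) g :
  inverse f g -> inverse g f.
Proof. by case. Qed.

Lemma trace_spherical (k : fieldType) (C : rigidCat k) (p : pivotal C) :
  finite_abelian C -> simple_object (one : C) ->
  has_nonzero_modified_trace p -> spherical p.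
Proof.
move=> finC simple1 [t trt nz].
have [J [JE coendJ]] := trace_coend finC simple1 trt nz.
have [pw _] := copower_ex finC.
have nakP_id M : nak_coend (fun Z => cop_desc (pw (dualv (hom M Z)) Z) (J Z M)).
  apply/nak_coendP; have [dinatJ univJ] := coendJ M; split.
    by move=> Z Z' h phi; rewrite !cop_descK.
  move=> W' J' /univJ[g [gJ g_uniq]]; exists g; split=> [Z phi | g' g'J].
    by rewrite cop_descK.
  by apply: g_uniq => Z phi; rewrite -g'J cop_descK.
pose N : nakayama C := Nakayama nakP_id.
have iotaE Z M phi : nak_iota N Z M phi = J Z M phi.
  by rewrite /nak_iota /= cop_descK.
have [G [I [tau [sepG _ /dualizing_projective hG]]]] :=
  finite_abelian_generator finC.
have qK X := piv_birdualK p X.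
exists N, (fun M X => idm M \om pivV p X), (fun M X => idm M \om piv p X),
  (fun X M => piv_birdual p X \om idm M); split.
- apply/nak_PsiP => M X Z phi; rewrite !iotaE tensm_swap -tensmM compm1 comp1m.
  have t_right (P Y : C) (hP : projective P) (hPY : projective (P \ox Y)) f :
      t P hP (close (coev Y) (ev Y^l) f) = t _ hPY ((idm P \om pivV p Y) \oc f).
    by rewrite -clrE (mtr_right trt hP hPY).
  apply/esym; apply: (represents_close (ldualP (r := C))
    (mtr_cyclic trt) t_right (trace_nondegl finC simple1 trt nz) sepG hG _
    (JE _ _ phi) (JE _ _ _)) => f.
  by rewrite dualE comp_lfunE clrmE clrE.
- by move=> M X; apply: inverse_tens (inverse_id _) (inverse_sym (pivK p X)).
- apply/nak_PhiP => X M Z phi; rewrite !iotaE -tensm_swap -tensmM compm1 comp1m.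
  (* Read in [revCat], the left partial trace property is a right one with [piv_birdual] in the role
     of [qV]. *)
  have t_left (P Y : revCat C) (hP : projective P) (hPY : projective (P \ox Y))
    f :
      t P hP (close (C := revCat C) (coevr Y) (evr Y^r) f) =
      t _ hPY (tensm (m := revCat C) (idm P) (piv_birdual p Y) \oc f).
    by rewrite -cllE (mtr_left trt hP hPY).
  apply/esym; apply: (represents_close (C := revCat C)
    (right_duality_rev (rdualP (r := C))) (mtr_cyclic trt) t_left
    (trace_nondegl finC simple1 trt nz) sepG hG _ (JE _ _ phi) (JE _ _ _)) => f.
  by rewrite dualE comp_lfunE cllmE cllE.
- move=> X M; exists (piv_birdualV p X \om idm M).
  exact: inverse_tens (inverse_sym (qK X)) (inverse_id _).
exists (idm one) => [|X]; first by exists (idm one); apply: inverse_id.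
rewrite /radford /= !tensm1 compm1 comp1m.
(* The chosen [N] is the identity on objects, so this cast is the strict identification of
   [X \ox one] with [one \ox X]. *)
have -> : nak_unit_cast N X = luV X \oc ru X.
  by rewrite /luV /ru castm_comp; apply: castm_irr.
rewrite -[LHS]compA -ruV_nat compA -[_ \oc ruV X]compA -[luV X \oc _ \oc
  _]compA.
by rewrite ruVK compm1 -luV_nat.
Qed.

(** * Duals of morphisms and of tensor products *)

Section DualityCalculus.
Variables (k : fieldType) (C : monCat k) (d : C -> C).
Variables (e : forall X, hom (d X \ox X) one) (c : forall X,
  hom one (X \ox d X)).
Hypothesis dualC : left_duality e c.
Implicit Types X Y Z M N P Q : C.

Let zig1 X := (dualC X).1.
Let zig2 X := (dualC X).2.

Lemma ldualmE P Q (h : hom P Q) :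
  ldualm e c h =
  lu (d P) \oc ((e Q \oc (idm (d Q) \om h)) \om idm (d P)) \oc unitr (c P) (d
    Q).
Proof.
rewrite /ldualm /unitr -lock tensm_compl !compA; do 2 congr (_ \oc _).
by rewrite -[LHS]compA assoV_nat !compA.
Qed.

Lemma ev_ldualm P Q (h : hom P Q) :
  e P \oc (ldualm e c h \om idm P) = e Q \oc (idm (d Q) \om h).
Proof.
rewrite ldualmE -[lu _ \oc _ \oc _]compA tensm_compl compA -counitr_one.
exact: untransposeK (zig1 P) _ _ _.
Qed.

Lemma counitr_ldualm P Q (h : hom P Q) M :
  counitr (e P) M \oc (idm M \om ldualm e c h \om idm P) =
  counitr (e Q) M \oc (idm (M \ox d Q) \om h).
Proof.
rewrite /counitr -!lock -compA asso_nat compA -[ru M \oc _ \oc _]compA.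
rewrite -tensm_compr ev_ldualm tensm_compr -tensm1 -[RHS]compA asso_nat.
by rewrite !compA.
Qed.

Lemma coev_ldualm P Q (h : hom P Q) :
  (idm Q \om ldualm e c h) \oc c Q = (h \om idm (d P)) \oc c P.
Proof.
apply: (transpose_inj (zig2 P)).
rewrite !tensm_compl !compA counitr_ldualm counitr_nat.
rewrite -[LHS]compA tensm_swap compA -[RHS]compA.
by rewrite !(counitr_coev (zig1 _)) lu_nat.
Qed.

Lemma counitr_tens X D (a : hom (D \ox X) one) M Z :
  heq (counitr a (M \ox Z)) (idm M \om counitr a Z).
Proof.
rewrite /counitr -!lock !tensm_compr; apply: heq_comp.
  apply: heq_comp; last by rewrite -tensm1; apply: heq_tensA.
  apply: heq_cast; rewrite ?tensA //; first exact: is_cast_ru.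
  by apply: is_cast_tens; [apply: is_cast_id | apply: is_cast_ru].
apply: heq_cast; rewrite ?tensA //; first exact: is_cast_asso.
by apply: is_cast_tens; [apply: is_cast_id | apply: is_cast_asso].
Qed.

Lemma ev_tensE X Y :
  ev_tens e X Y \oc asso (d Y \ox d X) X Y =
  e Y \oc (counitr (e X) (d Y) \om idm Y).
Proof.
rewrite /ev_tens /counitr -lock -[LHS]compA -[LHS]compA; congr (_ \oc _).
apply: heqE; rewrite !tensm_compr !tensm_compl -compA.
apply: heq_comp.
  apply: heq_comp; last by apply: heq_sym; apply: heq_tensA.
  apply: heq_cast; rewrite ?tensA ?tens1X //.
    by apply: is_cast_tens; [apply: is_cast_id | apply: is_cast_lu].
  by apply: is_cast_tens; [apply: is_cast_ru | apply: is_cast_id].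
apply: heq_cast => //.
  apply: is_cast_comp; first by apply: is_cast_tens;
    [apply: is_cast_id | apply: is_cast_assoV].
  by apply: is_cast_comp; apply: is_cast_asso.
by apply: is_cast_tens; [apply: is_cast_asso | apply: is_cast_id].
Qed.

Lemma counitr_ev_tens X Y M :
  ru M \oc (idm M \om ev_tens e X Y) \oc asso M (d Y \ox d X) (X \ox Y)
    \oc (asso M (d Y) (d X) \om idm (X \ox Y)) \oc asso (M \ox d Y \ox d X) X Y
      =
  counitr (e Y) M \oc (counitr (e X) (M \ox d Y) \om idm Y).
Proof.
have -> : ev_tens e X Y =
    e Y \oc (counitr (e X) (d Y) \om idm Y) \oc assoV (d Y \ox d X) X Y.
  by rewrite -ev_tensE -compA assoVK compm1.
rewrite !tensm_compr {2}/counitr -lock; apply: heqE.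
rewrite -!compA; apply: heq_comp; first exact: heq_refl.
apply: heq_comp; first exact: heq_refl.
apply: (@heq_trans _ _ _ _ _ _ _ _ _ (idm M \om (counitr (e X) (d Y) \om idm
  Y))).
  apply: heq_castr; apply: is_cast_comp.
    by apply: is_cast_tens; [apply: is_cast_id | apply: is_cast_assoV].
  apply: is_cast_comp; first exact: is_cast_asso.
  by apply: is_cast_comp; [apply: is_cast_tens; [apply: is_cast_asso |
    apply: is_cast_id] | apply: is_cast_asso].
apply: heq_sym; apply: heq_trans (heq_castl _ (is_cast_asso _ _ _)) _.
apply: heq_trans (heq_tensA _ _ _).
by apply: heq_tens (heq_refl _); apply: counitr_tens.
Qed.

Variable dM : forall X Y, d Y \ox d X = d (X \ox Y).
Hypothesis evM : forall X Y,
  e (X \ox Y) \oc (castm (dM X Y) \om idm (X \ox Y)) = ev_tens e X Y.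

Definition dual_tens X Y : hom (X \ox Y \ox d Y \ox d X) (X \ox Y \ox d (X \ox
  Y)) :=
  locked ((idm (X \ox Y) \om castm (dM X Y)) \oc asso (X \ox Y) (d Y) (d X)).

(** Both sides have the same transpose: the evaluation at [X \ox Y] is a pair of nested counits,
    which cancel the two coevaluations one after the other. *)
Lemma coev_tens X Y :
  c (X \ox Y) = dual_tens X Y \oc (unitr (c Y) X \om idm (d X)) \oc c X.
Proof.
apply: (transpose_inj (zig2 (X \ox Y))).
rewrite (counitr_coev (zig1 _)) !tensm_compl !compA.
have counitrM : counitr (e (X \ox Y)) (X \ox Y) \oc
    (dual_tens X Y \om idm (X \ox Y)) \oc asso _ X Y =
    counitr (e Y) (X \ox Y) \oc (counitr (e X) (X \ox Y \ox d Y) \om idm Y).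
  rewrite -counitr_ev_tens /dual_tens -lock tensm_compl compA {1}/counitr -lock.
  do 2 congr (_ \oc _).
  by rewrite -[LHS]compA asso_nat compA -[ru _ \oc _ \oc _]compA -tensm_compr
    evM.
have splitc : (unitr (c Y) X \om idm (d X) \om idm (X \ox Y)) \oc (c X \om idm
  (X \ox Y)) =
    asso _ X Y \oc (((unitr (c Y) X \om idm (d X) \om idm X) \oc (c X \om idm
      X)) \om idm Y)
      \oc assoV one X Y.
  rewrite -!tensm_compl asso_nat -[RHS]compA assoVK compm1 tensm1 //.
rewrite -[_ \oc (c X \om _)]compA splitc !compA counitrM.
rewrite -[counitr (e Y) _ \oc _ \oc _]compA -tensm_compl compA counitr_nat.
rewrite -[unitr _ _ \oc _ \oc _]compA (counitr_coev (zig1 _)).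
rewrite tensm_compl compA (counitr_unitr (zig1 _)) comp1m.
apply: is_cast_eq; first exact: is_cast_lu.
apply: is_cast_comp; last exact: is_cast_assoV.
by apply: is_cast_tens; [apply: is_cast_lu | apply: is_cast_id].
Qed.

Variable q : forall X, hom X (d (d X)).
Hypothesis q_tens : forall X Y,
  q (X \ox Y) = castm (etrans (dM (d Y) (d X)) (congr1 d (dM X Y))) \oc (q X \om
    q Y).
Hypothesis q_nat : forall X Y (f : hom X Y),
  q Y \oc f = ldualm e c (ldualm e c f) \oc q X.

(** The evaluation on the opposite side, available thanks to [q]. *)
Definition qev X : hom (X \ox d X) one := e (d X) \oc (q X \om idm (d X)).

Lemma qev_nat P Q (h : hom P Q) :
  qev Q \oc (h \om idm (d Q)) = qev P \oc (idm P \om ldualm e c h).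
Proof.
rewrite /qev -[LHS]compA -tensm_compl q_nat tensm_compl compA ev_ldualm.
by rewrite -[LHS]compA tensm_swap compA.
Qed.

Lemma counitr_qev X M :
  counitr (qev X) M = counitr (e (d X)) M \oc (idm M \om q X \om idm (d X)).
Proof.
by rewrite /counitr -!lock /qev tensm_compr -[RHS]compA asso_nat !compA.
Qed.

Lemma qev_tens X Y :
  qev (X \ox Y) \oc dual_tens X Y = qev X \oc (counitr (qev Y) X \om idm (d X)).
Proof.
(* The object [Z] is kept variable so that the equality [a] can be eliminated. *)
have ev_cast Z (a : d Y \ox d X = Z) (b : d (d X) \ox d (d Y) = d Z) :
    e Z \oc (castm b \om castm a) = ev_tens e (d Y) (d X).
  by case: _ / a b => b; rewrite -evM (castm_irr b (dM (d Y) (d X))).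
rewrite /qev /dual_tens -lock compA -[e _ \oc _ \oc _]compA tensm_split q_tens.
rewrite -[castm (dM X Y)]compm1 tensmM compA ev_cast -tensm1 -compA.
rewrite -asso_nat compA ev_tensE -[LHS]compA -tensm_compl.
rewrite -[RHS]compA -tensm_compl; congr (_ \oc (_ \om _)).
rewrite -/(qev Y) counitr_qev compA -counitr_nat -compA -tensm_compl.
by rewrite tensm_split.
Qed.

End DualityCalculus.

(** * The one-sided trace attached to a morphism [f] from the unit to the coend *)

Section CanonicalTrace.
Variables (k : fieldType) (C : monCat k) (d : C -> C).
Variables (e : forall X, hom (d X \ox X) one) (c : forall X,
  hom one (X \ox d X)).
Hypothesis dualC : left_duality e c.
Variable dM : forall X Y, d Y \ox d X = d (X \ox Y).
Hypothesis evM : forall X Y,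
  e (X \ox Y) \oc (castm (dM X Y) \om idm (X \ox Y)) = ev_tens e X Y.
Variables (q : forall X, hom X (d (d X))) (qV : forall X : C, hom (d (d X)) X).
Hypothesis qK : forall X, inverse (q X) (qV X).
Hypothesis q_tens : forall X Y,
  q (X \ox Y) = castm (etrans (dM (d Y) (d X)) (congr1 d (dM X Y))) \oc (q X \om
    q Y).
Hypothesis q_nat : forall X Y (f : hom X Y),
  q Y \oc f = ldualm e c (ldualm e c f) \oc q X.
Hypothesis finC : finite_abelian C.
Variables (al : C) (io : forall Z : C, 'Hom(dualv (hom one Z), hom Z al)).
Hypothesis coend_io : coend io.
Variable f : hom one al.
Implicit Types X Y Z M N P Q R : C.

(** The inverse is the generalized one of linear maps; it is a true inverse when [R] is projective,
    because [io R] is then bijective. *)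
Definition copair R (a : hom R one) : dualv (hom one R) :=
  ((io R)^-1)%VF (f \oc a).

Lemma io_copair R (a : hom R one) : projective R -> io R (copair a) = f \oc a.
Proof.
move=> projR; have [_ /(_ (f \oc a))[phi phiE]] :=
  coend_projective_bij finC coend_io projR.
by rewrite /copair limg_lfunVK // -phiE memv_img ?memvf.
Qed.

Lemma copair_nat R S (h : hom R S) (a : hom S one) (b : hom one R) :
  projective R -> projective S ->
  (copair (a \oc h) : 'Hom(_, k^o)) b = (copair a : 'Hom(_, k^o)) (h \oc b).
Proof.
move=> projR projS.
have [io_inj _] := coend_projective_bij finC coend_io projR.
suff -> : copair (a \oc h) = dualvm (postm one h) (copair a).
  by rewrite dualE comp_lfunE postmE.
apply/eqP; rewrite -subr_eq0; apply/eqP/io_inj.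
rewrite linearB /= io_copair // -(proj1 coend_io) io_copair //.
by rewrite compA subrr.
Qed.

Definition ctrace P : 'Hom(hom P P, k^o) :=
  linfun (fun g => (copair (qev e q P) : 'Hom(_,
    k^o)) ((g \om idm (d P)) \oc c P)).

Lemma ctraceE P (g : hom P P) :
  ctrace P g = (copair (qev e q P) : 'Hom(_, k^o)) ((g \om idm (d P)) \oc c P).
Proof.
by rewrite /ctrace linfun_linE // => a x y;
  rewrite tensm_linl comp_linl linearP.
Qed.

Let proj_tensr P X (projP : projective P) : projective (P \ox X) :=
  projective_tensr dualC (X := X) projP.

(** The morphism [h] slides around the loop: it crosses [qev] to become [ldualm e c h] on the dual
    strand, and crosses the coevaluation to return after [g] has been passed. *)
Lemma ctrace_cyclic P Q (g : hom P Q) (h : hom Q P) :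
  projective P -> projective Q -> ctrace P (h \oc g) = ctrace Q (g \oc h).
Proof.
move=> projP projQ; rewrite !ctraceE tensm_compl -compA.
rewrite -copair_nat; try exact: proj_tensr.
rewrite (qev_nat dualC q_nat) copair_nat; try exact: proj_tensr.
by rewrite compA tensm_swap -compA (coev_ldualm dualC) compA -tensm_compl.
Qed.

(** The loop around [P \ox X] splits into nested loops by [coev_tens] and [qev_tens]; the inner one,
    around [X], is the closing operator. *)
Lemma ctrace_right P X (h : hom (P \ox X) (P \ox d (d X))) :
  projective P ->
  ctrace P (close (c X) (e (d X)) h) =
    ctrace (P \ox X) ((idm P \om qV X) \oc h).
Proof.
move=> projP; rewrite !ctraceE (coev_tens dualC evM).
set h' := _ \oc h.
have hE : h = (idm P \om q X) \oc h'.
  by rewrite /h' compA -tensmM comp1m (qK X).2 tensm1 comp1m.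
have dual_nat : (h' \om idm (d (P \ox X))) \oc dual_tens dM P X =
    dual_tens dM P X \oc (h' \om idm (d X) \om idm (d P)).
  rewrite /dual_tens -lock compA -[in RHS]compA asso_nat tensm1 compA.
  by rewrite !tensm_swap.
rewrite !compA dual_nat -!compA -(copair_nat (dual_tens dM P X));
  try by do ?apply: proj_tensr.
rewrite (qev_tens evM q_tens) copair_nat; try by do ?apply: proj_tensr.
rewrite !compA -!tensm_compl counitr_qev; congr (_ ((_ \om _) \oc _)).
by rewrite /close {1}hE tensm_compl !compA.
Qed.

(** The property of [Psi] is applied with [Z] equal to [P \ox d P] and the functional
    [copair (qev e q P)], then composed with the unit [w]. By dinaturality one side becomes
    [io' P phi]; on the other a zigzag reduces [qev] to [q P]. *)
Lemma io_ctrace P (be : C) (io' : forall Z : C, 'Hom(dualv (hom (one \ox P) Z),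
  hom Z be))
    (Psi : hom (al \ox d (d P)) be) (phi : dualv (hom (one \ox P) P)) :
  projective P -> dinatural io' ->
  (forall Z (psi : dualv (hom one Z)) (psi' : dualv (hom (one \ox P) (Z \ox d (d
    P)))),
     (forall y, (psi' : 'Hom(_, k^o)) y =
       (psi : 'Hom(_, k^o)) (close (c P) (e (d P)) y)) ->
     Psi \oc (io Z psi \om idm _) = io' (Z \ox d (d P)) psi') ->
  (forall y, (phi : 'Hom(_, k^o)) y = ctrace P (y \oc luV P)) ->
  io' P phi = Psi \oc (f \om idm _) \oc luV _ \oc q P.
Proof.
move=> projP dinat' PsiE phiE.
pose w := unitr (c (d P)) P.
pose lam := copair (qev e q P).
have lin : linear (fun y => (lam : 'Hom(_, k^o)) (close (c P) (e (d P)) (M :=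
  one) y)).
  move=> a x y; rewrite /close tensm_linl comp_linr comp_linl.
  by rewrite linearP.
pose psi' : dualv (hom (one \ox P) (P \ox d P \ox d (d P))) :=
  linfun (fun y => (lam : 'Hom(_, k^o)) (close (c P) (e (d P)) y)).
have psi'E y : (psi' : 'Hom(_, k^o)) y =
  (lam : 'Hom(_, k^o)) (close (c P) (e (d P)) y).
  exact: (linfun_linE lin).
have := congr1 (fun g => g \oc w) (PsiE _ lam psi' psi'E).
rewrite dinat' io_copair; last exact: proj_tensr.
have -> : dualvm (postm (one \ox P) w) psi' = phi.
  apply/lfunP => y; rewrite phiE ctraceE dualE comp_lfunE postmE psi'E.
  congr ((lam : 'Hom(_, k^o)) _).
  rewrite /close tensm_compl compA (counitr_unitr (dualC (d P)).1) comp1m.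
  rewrite tensm_compl -compA; congr (_ \oc _).
  by rewrite -{2}(unitr_one (c P)) compA -tensm_compl luK tensm1 comp1m.
move=> <-; rewrite tensm_compl -!compA; congr (_ \oc (_ \oc _)).
rewrite /qev tensm_compl -compA -unitr_nat compA.
by rewrite (unitr_ev (dualC (d P)).2).
Qed.

End CanonicalTrace.

(** * Monoidality of right duals and of the reversed pivotal structure *)

Section ReverseRigid.
Variables (k : fieldType) (C : rigidCat k).
Implicit Types X Y Z : C.

Lemma ev_tens_rev X Y :
  ev_tens (C := revCat C) (@evr k C) X Y = evr_tens (@evr k C) Y X.
Proof.
rewrite /ev_tens /evr_tens -!compA; congr (_ \oc _); apply: heqE.
rewrite assoV_rev /= tensm_compr !tensm_compl asso_rev -!compA.
apply: heq_comp.
  apply: heq_cast; rewrite ?tensA ?tensX1 ?tens1X //.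
    by apply: is_cast_tens; [apply: is_cast_ru | apply: is_cast_id].
  by apply: is_cast_tens; [apply: is_cast_id | apply: is_cast_lu].
rewrite tensm_compr -!compA; apply: heq_comp; first exact: heq_tensA.
apply: heq_cast => //.
  apply: is_cast_comp; last exact: is_cast_assoV.
  by apply: is_cast_tens; [apply: is_cast_asso | apply: is_cast_id].
apply: is_cast_comp; last exact: is_cast_asso.
by apply: is_cast_tens; [apply: is_cast_id | apply: is_cast_assoV].
Qed.

Lemma evr_tensM X Y :
  evr (Y \ox X) \oc (idm (Y \ox X) \om castm (rdualM Y X)) =
  ev_tens (C := revCat C) (@evr k C) X Y.
Proof. by rewrite ev_tens_rev (proj1 (rdual_strict C)). Qed.

Variable p : pivotal C.

Lemma piv_cast (X Y : C) (E : X = Y) (E' : X^l^l = Y^l^l) :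
  piv p Y \oc castm E = castm E' \oc piv p X.
Proof. by case: _ / E E' => E'; rewrite !castm_id compm1 comp1m. Qed.

Lemma piv_birdualV_tens X Y (E : X^r^r \ox Y^r^r = (X \ox Y)^r^r) :
  piv_birdualV p (X \ox Y) =
    castm E \oc (piv_birdualV p X \om piv_birdualV p Y).
Proof.
have qE : piv_birdual p (X \ox Y) \oc castm E =
  piv_birdual p X \om piv_birdual p Y.
  rewrite /piv_birdual -compA (piv_cast _ (congr1 (fun Z => Z^l^l) E)) piv_tens.
  rewrite tensmM !compA; congr (_ \oc _); apply: is_cast_eq.
    by rewrite !castm_comp; apply: is_castm.
  by apply: is_cast_tens; apply: is_castm.
rewrite -[RHS]comp1m -(piv_birdualK p (X \ox Y)).2 -[RHS]compA.
rewrite [piv_birdual _ _ \oc _]compA qE -tensmM !(piv_birdualK p _).1 tensm1.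
by rewrite compm1.
Qed.

End ReverseRigid.

Lemma nak_iota_cast (k : fieldType) (C : linCat k) (N : nakayama C) (Z M M' : C)
    (E : M = M') phi :
  castm (congr1 N E) \oc nak_iota N Z M phi =
  nak_iota N Z M' (dualvm (prem Z (castm E)) phi).
Proof.
case: _ / E; rewrite comp1m; congr (nak_iota _ _ _ _).
by apply/lfunP => y; rewrite dualE comp_lfunE premE compm1.
Qed.

(** * A modified trace from sphericality, and the equivalence *)

Lemma spherical_trace (k : fieldType) (C : rigidCat k) (p : pivotal C) :
  finite_abelian C -> simple_object (one : C) ->
  spherical p -> has_nonzero_modified_trace p.
Proof.
move=> finC simple1 [N [Psi [PsiV [Phi [/nak_PsiP PsiE PsiK /nak_PhiP PhiE
  _]]]]].
case=> f [fV [fVK fKV]] radE.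
have dualR := right_duality_rev (rdualP (r := C)).
have qK X := piv_birdualK p X.
pose T (P : C) := ctrace (@ev k C) (@coev k C) (piv p) (fun Z =>
  nak_iota N Z one) f P.
(* The mirror image of [T]: the same construction in [revCat], from the same coend and the same
   [f]. *)
pose T' (P : C) := ctrace (C :=
  revCat C) (@evr k C) (@coevr k C) (piv_birdualV p)
  (fun Z => nak_iota N Z one) f P.
have coend1 := nak_iota_coend N one.
pose phi P : dualv (hom (one \ox P) P) :=
  linfun (fun y => T P (y \oc luV P)).
have phiE P y : (phi P : 'Hom(_, k^o)) y = T P (y \oc luV P).
  by rewrite /phi linfun_linE // => a u v; rewrite comp_linl linearP.
pose phi' P : dualv (hom (P \ox one) P) :=
  linfun (fun y => T' P (y \oc ruV P)).
have phi'E P y : (phi' P : 'Hom(_, k^o)) y = T' P (y \oc ruV P).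
  by rewrite /phi' linfun_linE // => a u v; rewrite comp_linl linearP.
have io_phi P : projective P -> nak_iota N P (one \ox P) (phi P) =
    Psi one P \oc (f \om idm _) \oc luV _ \oc piv p P.
  move=> projP; apply: (io_ctrace (ldualP (r := C)) finC coend1 projP
    (proj1 (nak_iota_coend N _)) _ (phiE P)) => Z psi psi' psi'E.
  rewrite PsiE; congr (nak_iota _ _ _ _); apply/lfunP => y.
  by rewrite psi'E dualE comp_lfunE clrmE clrE.
have io_phi' P : projective P -> nak_iota N P (P \ox one) (phi' P) =
    Phi P one \oc (idm _ \om f) \oc ruV _ \oc piv_birdualV p P.
  move=> projP; apply: (io_ctrace (C := revCat C) dualR finC coend1 projP
    (proj1 (nak_iota_coend N _)) _ (phi'E P)) => Z psi psi' psi'E.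
  rewrite [LHS]PhiE; congr (nak_iota _ _ _ _); apply/lfunP => y.
  by rewrite psi'E dualE comp_lfunE cllmE cllE.
have TT' P (g : hom P P) : projective P -> T P g = T' P g.
  move=> projP.
  have [io_inj _] := coend_projective_bij finC (nak_iota_coend N (one \ox P))
    projP.
  pose E := etrans (tensX1 P) (esym (tens1X P)).
  have phi_eq : phi P = dualvm (prem P (castm E)) (phi' P).
    apply/eqP; rewrite -subr_eq0; apply/eqP/io_inj; rewrite linearB /=.
    rewrite -nak_iota_cast io_phi // io_phi' // -[Psi _ _ \oc _ \oc _ \oc
      _]compA.
    apply/eqP; rewrite subr_eq0; apply/eqP.
    (* After cancelling [PsiV] against [Psi] and [piv_birdual] against its inverse, the spherical
       condition equates the images of the functionals of [T] and [T']; injectivity of [nak_iota] at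
       [P] concludes. *)
    have /(congr1 (fun h => Psi one P \oc (h \oc piv_birdualV p P))) := radE P.
    rewrite -![_ \oc piv_birdual p P \oc _]compA (qK P).1 compm1.
    rewrite /radford /nak_unit_cast !compA (PsiK one P).2 comp1m => ->.
    by rewrite -!compA.
  have := phiE P (g \oc lu P); rewrite -compA luVK compm1 => <-.
  rewrite phi_eq dualE comp_lfunE premE phi'E; congr (T' P _).
  rewrite -!compA -[RHS]compm1; congr (_ \oc _).
  apply: is_cast_eq; last exact: is_cast_id.
  apply: is_cast_comp; first exact (is_cast_lu P).
  by apply: is_cast_comp; [apply: is_castm | exact (is_cast_ruV P)].
exists (fun P _ => T P).
- split=> [P Q hP hQ g h | P X hP hPX g | P X hP hXP g].
  + exact: (ctrace_cyclic (ldualP (r := C)) (piv_natural p) finC coend1).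
  + rewrite clrE; apply: (ctrace_right (ldualP (r :=
    C)) (proj1 (ldual_strict C))
      (pivK p) (piv_tens p) finC coend1 f g hP).
  (* The left property is the right one for [T'] in [revCat]. *)
  + rewrite !TT' // cllE.
    have tensR (Y Z : C) : piv_birdualV p (Z \ox Y) =
        castm (etrans (rdualM Y^r Z^r) (congr1 (@rdual k C) (rdualM Z Y))) \oc
        (piv_birdualV p Z \om piv_birdualV p Y).
      exact: piv_birdualV_tens.
    exact: (ctrace_right (C := revCat C) dualR (@evr_tensM k C) qK tensR finC
      coend1 f g hP).
(* If [T] vanished at [G], the invertible morphism of [io_phi] at [G] would be zero, hence so would
   [idm G]. As [G] separates, the unit object would be zero, against simplicity. *)
have [G [I [tau [sepG _ /dualizing_projective hG]]]] :=
  finite_abelian_generator finC.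
exists G, hG; apply: NNPP => noT; apply: simple1.1.
have T0 g : T G g = 0 by apply: NNPP => Tg; apply: noT; exists g.
have phi0 : phi G = 0 by apply/lfunP => y; rewrite phiE T0 zero_lfunE.
have := io_phi G hG; rewrite phi0 linear0.
have fI := inverse_tens (conj fVK fKV : inverse f fV) (inverse_id G^l^l).
move/(congr1 (fun h => pivV p G \oc (lu _ \oc ((fV \om idm _) \oc (PsiV one G
  \oc h))))).
rewrite !comp0r !compA -[_ \oc PsiV _ _ \oc _]compA (PsiK one G).1 compm1.
rewrite -[_ \oc (fV \om _) \oc _]compA fI.1 compm1 -[_ \oc lu _ \oc _]compA luVK
  compm1 (pivK p G).1.
move=> G0; apply: (separating_eq sepG) => z.
by rewrite -[z]compm1 -G0 !comp0r.
Qed.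

Theorem theorem1p3 (k : closedFieldType) (C : finTensCat k) (p : pivotal C) :
  has_nonzero_modified_trace p <-> spherical p.
Proof.
have finC := ftc_finite_abelian C; have simple1 := ftc_simple_one C.
by split; [apply: trace_spherical | apply: spherical_trace].
Qed.
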